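(* Let $n$ be a positive integer. If $n\geq 11$ then $m(n)\geq 4$. If $n\geq 17$ then $m(n)\geq 6$. If $n\geq 21$ then $m(n)\geq 8$. Moreover, in each of these cases it is possible to choose, respectively, four (if $n\ge 11$), six (if $n\ge 17$) and eight (if $n\ge 21$) distinct irreducible complex characters of the symmetric group $S_n$ that all have the same degree and each of which has irreducible restriction to the alternating group $A_n$.
   Context: For a finite group $G$, $m(G)$ denotes the maximal multiplicity of an irreducible character degree of $G$, i.e., the maximum over positive integers $d$ of the number of irreducible complex characters $\chi$ of $G$ with $\chi(1)=d$. Write $m(n)=m(S_n)$, where $S_n$ is the symmetric group of degree $n$. *)

(* Defs.v *)
From mathcomp Require Import all_boot all_order all_algebra all_fingroup.
From mathcomp Require Import all_solvable all_field all_character.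

Set Implicit Arguments.
Unset Strict Implicit.
Unset Printing Implicit Defensive.

Import Order.TTheory GRing.Theory Num.Theory.
Local Open Scope ring_scope.

Definition degree_mult (gT : finGroupType) (G : {group gT}) (d : nat) : nat :=
  #|[set i : Iirr G | 'chi_i 1%g == d%:R]|.

(* The range of d is cut at #|G| because irreducible character degrees divide
   #|G|; degree_mult_le_max shows that nothing is lost. *)
Definition max_degree_mult (gT : finGroupType) (G : {group gT}) : nat :=
  (\max_(1 <= d < #|G|.+1) degree_mult G d)%N.

Lemma degree_mult_le_max (gT : finGroupType) (G : {group gT}) (d : nat) :
  (0 < d)%N -> (degree_mult G d <= max_degree_mult G)%N.
Proof.
move=> d_gt0; case: (leqP d #|G|) => [le_dG | lt_Gd].
  by apply: leq_bigmax_seq; rewrite // mem_index_iota d_gt0 ltnS.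
rewrite /degree_mult; set A := [set i | _].
have [-> | [i]] := set_0Vmem A; first by rewrite cards0.
rewrite inE irr1_degree eqr_nat => /eqP def_d.
have := dvd_irr1_cardG i; rewrite irr1_degree def_d dvdC_nat.
by move/(dvdn_leq (cardG_gt0 G)); rewrite leqNgt lt_Gd.
Qed.

Definition m (n : nat) : nat := max_degree_mult 'Sym_('I_n)%G.

Definition same_degree_Alt_irr (n k : nat) : Prop :=
  exists S : {set Iirr 'Sym_('I_n)},
    [/\ #|S| = k,
        {in S &, forall i j, 'chi_i 1%g = 'chi_j 1%g}
      & {in S, forall i, 'Res['Alt_('I_n)] 'chi_i \in irr 'Alt_('I_n)}].

(* Main.v *)
From Stdlib Require Import NArith.
Require Import Defs.
From mathcomp Require Import all_boot all_order all_algebra all_fingroup.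
From mathcomp Require Import all_solvable all_field all_character.
From mathcomp Require Import mpoly.
From mathcomp Require Import ring zify.

(** The irreducible characters of S_n are built from Frobenius' formula.  Encode
    a partition of n into at most k parts by its beta-numbers l, a strictly
    increasing k-tuple with sum n + k(k-1)/2, and let
      chi_l(s) = sum_(w in S_k) sgn(w) #{f : [n] -> [k] | f o s = f and
                                         #f^-1(i) + w(i) = l(i) for all i}.
    By Burnside's lemma the inner product of chi_l and chi_m is a signed count
    of nonnegative integer matrices with prescribed margins, and Cauchy's
    determinant det(1/(1 - x_i y_j)) evaluates it to [l = m]; a Vandermonde
    determinant gives chi_l(1) = n! prod_(i<j) (l_j - l_i) / prod_i l_i! > 0.
    So the chi_l are distinct irreducible characters.

    If the first row of l is longer than the first column of m, then
    chi_m <> sgn chi_l: some word f using its last letter more often than m has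
    rows satisfies sum_(s in Stab f) chi_l(s) <> 0, while
    sum_(s in Stab f) sgn(s) chi_m(s) = 0, because every word g contributing to
    chi_m takes equal values at two points of that fibre of f, and the
    transposition of these points fixes both f and g.  In particular
    chi_l <> sgn chi_l, so that chi_l restricts irreducibly to A_n.

    It remains to find, for every n, two, three or four partitions with equal
    hook products and long first rows.  A finite table does it for n < 84.  For
    n >= 84 surround a partition mu of 49 (n even) or 50 (n odd) by a first row
    of length A and a first column of length A - 2: for the four mu chosen the
    hook products agree identically in A. *)

Set Implicit Arguments.
Unset Strict Implicit.
Unset Printing Implicit Defensive.

Import GroupScope Order.TTheory GRing.Theory Num.Theory.
Local Open Scope ring_scope.

(** * Words and permutation characters *)

Section Words.

Variables (n N : nat) (T : finType).
Implicit Types (f g : {ffun 'I_n -> T}) (s t : {perm 'I_n}) (x : T).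

Definition permw f s : {ffun 'I_n -> T} := [ffun a => f (s a)].

Definition letters f x : nat := #|[set a | f a == x]|.

(* The bound [N >= n] only serves to make the type of contents finite. *)
Definition content f : {ffun T -> 'I_N.+1} := [ffun x => inord (letters f x)].

Hypothesis le_nN : (n <= N)%N.

Lemma contentE f x : content f x = letters f x :> nat.
Proof.
rewrite ffunE inordK // ltnS (leq_trans _ le_nN) // -[leqRHS]card_ord.
exact: max_card.
Qed.

Lemma permw1 f : permw f 1%g = f.
Proof. by apply/ffunP=> a; rewrite ffunE perm1. Qed.

Lemma permwM f s t : permw f (s * t)%g = permw (permw f t) s.
Proof. by apply/ffunP=> a; rewrite !ffunE permM. Qed.

Lemma permwK f s : permw (permw f s) s^-1%g = f.
Proof. by rewrite -permwM mulVg permw1. Qed.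

Lemma letters_permw f s x : letters (permw f s) x = letters f x.
Proof.
rewrite /letters -(card_imset _ (@perm_inj _ s)).
congr #|pred_of_set _|; apply/setP=> a; rewrite !inE.
apply/imsetP/idP=> [[b]|fa]; first by rewrite inE ffunE => fb ->.
by exists (s^-1%g a); rewrite ?permKV // inE ffunE permKV.
Qed.

Lemma content_permw f s : content (permw f s) = content f.
Proof. by apply/ffunP=> x; rewrite !ffunE letters_permw. Qed.

Lemma sum_letters f : (\sum_x letters f x)%N = n.
Proof.
rewrite -[RHS]card_ord -sum1_card (partition_big f xpredT) //=.
by apply: eq_bigr => x _; rewrite sum1_card /letters cardsE.
Qed.

Lemma eq_content_permw f g : content f = content g -> exists s, permw f s = g.
Proof.
move=> eq_fg.
have /tuple_permP[s def_g]:
    perm_eq [tuple g a | a < n] [tuple f a | a < n].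
  apply/allP=> x _; apply/eqP.
  have /(congr1 (fun c : {ffun T -> 'I_N.+1} => c x : nat)) := eq_fg.
  rewrite !contentE /letters => eq_x.
  have cntE (h : {ffun 'I_n -> T}) : count (pred1 x) [tuple h a | a < n] = letters h x.
    rewrite -sum1_count big_map big_enum_cond sum1_card /letters cardsE.
    by apply: eq_card => a; rewrite !unfold_in.
  by rewrite !cntE.
exists s; apply/ffunP=> a; rewrite ffunE.
have := congr1 (fun u => nth (f a) u a) def_g.
by rewrite -!tnth_nth !tnth_mktuple => ->.
Qed.

Lemma content_surj (c : {ffun T -> 'I_N.+1}) :
  (\sum_x c x)%N = n -> exists f, content f = c.
Proof.
(* The witness lists the letters in blocks, [c x] copies of each letter [x]. *)
move=> sum_c; pose u := flatten [seq nseq (c x) x | x <- enum T].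
have size_u : size u == n.
  rewrite size_flatten /shape -map_comp sumnE big_map -[X in _ == X]sum_c.
  by rewrite big_enum /=; apply/eqP/eq_bigr => x _; rewrite /= size_nseq.
pose f := [ffun a => tnth (Tuple size_u) a].
exists f; apply/ffunP=> x; apply/val_inj; rewrite /= contentE.
have -> : letters f x = count (pred1 x) u.
  rewrite -[u]/(tval (Tuple size_u)) -[in RHS](map_tnth_enum (Tuple size_u)).
  rewrite -sum1_count big_map big_enum_cond sum1_card /letters cardsE.
  by apply: eq_card => a; rewrite !unfold_in ffunE.
rewrite count_flatten -map_comp sumnE big_map big_enum /= (bigD1 x) //=.
rewrite count_nseq /= eqxx mul1n big1 ?addn0 // => y /negPf y_x.
by rewrite count_nseq /= y_x.
Qed.

End Words.

(** * Orbits of words and their permutation characters *)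

Section WordCharacters.

Variables (n N : nat) (T : finType).
Hypothesis le_nN : (n <= N)%N.
Local Notation content := (@content n N T).
Implicit Types (f g : {ffun 'I_n -> T}) (s t : {perm 'I_n}) (x : T).
Implicit Types (c : {ffun T -> 'I_N.+1}).

(** Orbit-stabilizer: for a fixed word [f0] of content [c], the map [permw f0] partitions [S_n], and
    its fibre over [f] is a right translate of the stabilizer of [f]. *)
Lemma sum_stab_content c : (\sum_x c x)%N = n ->
  (\sum_(f : {ffun 'I_n -> T} | content f == c)
     #|[set s | permw f s == f]| = n`!)%N.
Proof.
case/(content_surj le_nN)=> f0 def_c.
transitivity (\sum_(s : {perm 'I_n}) 1)%N; last first.
  by rewrite sum1_card card_Sn.
rewrite (partition_big (permw f0) (fun f => content f == c)) /=; last first.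
  by move=> s _; rewrite content_permw def_c.
apply: eq_bigr => f /eqP def_f; have [|s0 def_s0] := @eq_content_permw _ _ _ le_nN f0 f.
  by rewrite def_c.
rewrite sum1dep_card -[LHS](card_imset _ (@mulIg _ s0)).
congr #|pred_of_set _|; apply/setP=> s; rewrite [RHS]inE.
apply/imsetP/eqP=> [[t + ->]|def_s]; first by rewrite inE permwM def_s0 => /eqP.
exists (s * s0^-1)%g; last by rewrite mulgKV.
by rewrite inE permwM -{1}def_s0 permwK def_s.
Qed.

(* Burnside: the S_n-orbits of words are their content classes. *)
Lemma sum_fixed_content (P : pred {ffun T -> 'I_N.+1}) :
  (\sum_(s : {perm 'I_n}) #|[set f | (permw f s == f) && P (content f)]|
   = n`! * #|[set c : {ffun T -> 'I_N.+1} | (\sum_x c x == n) && P c]|)%N.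
Proof.
transitivity
    (\sum_(f : {ffun 'I_n -> T} | P (content f)) #|[set s | permw f s == f]|)%N.
  under eq_bigr do rewrite -sum1_card big_mkcond.
  rewrite exchange_big /= [RHS]big_mkcond; apply: eq_bigr => f _.
  case: ifP => Pf; last by apply: big1 => s _; rewrite inE Pf andbF.
  by rewrite -sum1_card [RHS]big_mkcond; apply: eq_bigr => s _; rewrite !inE Pf andbT.
rewrite (partition_big content P) //= mulnC -sum_nat_const.
rewrite big_mkcond [RHS]big_mkcond; apply: eq_bigr => c _.
rewrite inE andbC; case: ifP => Pc //=.
case: eqP => [sum_c | sum_c].
  rewrite -(sum_stab_content sum_c); apply: eq_bigl => f.
  by case: eqP => [-> | _]; rewrite ?Pc ?andbT ?andbF.
rewrite big_pred0 // => f; apply: contra_notF sum_c => /andP[_ /eqP <-].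
by rewrite -[RHS](sum_letters f); apply: eq_bigr => x _; rewrite (contentE le_nN).
Qed.

(** By [permwM] the right-hand factor acts first, so the argument word must index the columns for
    this to be a homomorphism. *)
Definition wordmx c (s : {perm 'I_n}) :
    'M[algC]_#|[set f : {ffun 'I_n -> T} | content f == c]| :=
  \matrix_(i, j) (permw (enum_val j) s == enum_val i)%:R.

Lemma wordmx_repr c : mx_repr 'Sym_('I_n) (wordmx c).
Proof.
split=> [|s t _ _]; apply/matrixP=> i j; rewrite !mxE.
  by rewrite permw1 (inj_eq enum_val_inj) eq_sym.
have Sj : permw (enum_val j) t \in [set f | content f == c].
  by rewrite inE content_permw; have := enum_valP j; rewrite inE.
rewrite (bigD1 (enum_rank_in Sj (permw (enum_val j) t))) //= !mxE.
rewrite enum_rankK_in // eqxx mulr1 permwM big1 ?addr0 // => h.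
rewrite !mxE => ne_h; case: (permw (enum_val j) t =P _) => [def_h|_]; last by rewrite mulr0.
by rewrite -(enum_valK_in Sj h) -def_h eqxx in ne_h.
Qed.

Definition wordchar c : 'CF('Sym_('I_n)) :=
  cfRepr (MxRepresentation (wordmx_repr c)).

Lemma wordcharE c s :
  wordchar c s = #|[set f | (permw f s == f) && (content f == c)]|%:R.
Proof.
rewrite cfunE inE /= mulr1n /mxtrace.
under eq_bigr do rewrite mxE.
rewrite -natr_sum -(big_enum_val (A := mem [set f | content f == c])
  (fun f => permw f s == f : nat)) /=.
rewrite -sum1_card big_mkcond [in RHS]big_mkcond; congr _%:R.
by apply: eq_bigr => f _; rewrite !inE andbC; case: eqP; case: eqP.
Qed.

End WordCharacters.

(** * Cauchy's determinant *)

Section Cauchy.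

Variable k : nat.

Lemma det_powers (R : comPzRingType) (x : 'I_k -> R) :
  \det (\matrix_(i, j) x i ^+ j)
    = \prod_(i < k) \prod_(j < k | (i < j)%N) (x j - x i).
Proof.
rewrite -det_tr (_ : _^T = Vandermonde k (\row_i x i)); last first.
  by apply/matrixP=> i j; rewrite !mxE.
rewrite det_Vandermonde.
by apply: eq_bigr => i _; apply: eq_bigr => j _; rewrite !mxE.
Qed.

(** Reversing the rows as well as the columns costs the same sign twice, which reduces this to
    [det_powers]. *)
Lemma det_revpowers (R : comPzRingType) (x : 'I_k -> R) :
  \det (\matrix_(i, j) x i ^+ rev_ord j)
    = \prod_(i < k) \prod_(j < k | (i < j)%N) (x i - x j).
Proof.
pose r : {perm 'I_k} := perm (@rev_ord_inj k).
set N := \matrix_(i, j) _.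
have -> : \det N = \det (\matrix_(i, j) x (rev_ord i) ^+ j).
  rewrite (_ : \matrix_(_, _) _ = row_perm r (col_perm r N)).
    rewrite row_permE col_permE !det_mulmx !det_perm odd_permV [_ * (-1) ^+ _]mulrC.
    by rewrite mulrA -signr_addb addbb mul1r.
  by apply/matrixP=> i j; rewrite !mxE !permE rev_ordK.
rewrite det_powers (reindex_inj rev_ord_inj) /=.
under eq_bigr => i _ do rewrite (reindex_inj rev_ord_inj) /= !rev_ordK.
rewrite !pair_big_dep /=.
rewrite (reindex_inj (h := fun p : 'I_k * 'I_k => (p.2, p.1))) /=; last first.
  by move=> [a b] [c d] [-> ->].
apply: eq_big => [[i j]|[i j] _] /=; last by rewrite rev_ordK.
by rewrite ltn_sub2lE ?ltnS.
Qed.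

(** Both sides are x^d p(1/x) for p the product of the X - z and d its degree, written without
    division. *)
Lemma homogenized_prod (R : comNzRingType) (r : seq R) x :
  \sum_(s < (size r).+1) x ^+ (size r - s) * (\prod_(z <- r) ('X - z%:P))`_s
    = \prod_(z <- r) (1 - x * z).
Proof.
elim: r => [|z r IHr]; first by rewrite big_ord_recl !big_nil big_ord0 coef1 mulr1 addr0.
rewrite !big_cons -IHr /= [RHS]mulrBl mul1r.
set p := \prod_(y <- r) _.
have size_p : size p = (size r).+1 by rewrite size_prod_XsubC.
under eq_bigr do rewrite mulrBl coefB coefCM coefXM mulrBr.
rewrite big_split /= sumrN; congr (_ - _).
  rewrite big_ord_recl mulr0 add0r; apply: eq_bigr => i _.
  by rewrite /= subSS.
rewrite big_ord_recr /= nth_default ?size_p // !mulr0 addr0 mulr_sumr.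
apply: eq_bigr => i _; rewrite subSn; last by rewrite -ltnS.
by rewrite exprS -!mulrA; congr (_ * _); rewrite mulrCA.
Qed.

(** This is Cauchy's matrix with each row cleared of denominators. Expanding the entries in powers
    of [x i] factors it as a reversed Vandermonde matrix in [x] times the coefficient matrix [D] of
    the polynomials [Q j]. *)
Lemma det_cauchy (R : idomainType) (x y : 'I_k -> R) : injective y ->
  \det (\matrix_(i, j) \prod_(h | h != j) (1 - x i * y h))
    = (\prod_(i < k) \prod_(j < k | (i < j)%N) (x j - x i))
      * \prod_(i < k) \prod_(j < k | (i < j)%N) (y j - y i).
Proof.
move=> inj_y; set P := \matrix_(i, j) _.
pose Q j := \prod_(h | h != j) ('X - (y h)%:P).
pose ys j := [seq y h | h <- enum 'I_k & h != j].
have QE j : Q j = \prod_(z <- ys j) ('X - z%:P).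
  by rewrite /ys big_map big_filter big_enum_cond.
have size_ys j : (size (ys j)).+1 = k.
  transitivity #|'I_k|; last exact: card_ord.
  rewrite size_map size_filter -sum1_count big_enum_cond sum1_card.
  rewrite [RHS](cardD1 j) inE add1n.
  by congr _.+1; apply: eq_card => h; rewrite !unfold_in /= andbT.
have size_Q j : size (Q j) = k by rewrite QE size_prod_XsubC size_ys.
pose D := \matrix_(s < k, j < k) (Q j)`_s.
have defP : P = (\matrix_(i, j) x i ^+ rev_ord j) *m D.
  apply/matrixP=> i j; rewrite !mxE.
  transitivity (\prod_(z <- ys j) (1 - x i * z)).
    by rewrite /ys big_map big_filter big_enum_cond.
  rewrite -homogenized_prod -QE -(big_mkord xpredT
    (fun s => x i ^+ (size (ys j) - s) * (Q j)`_s)) size_ys big_mkord.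
  apply: eq_bigr => s _; rewrite !mxE /=; congr (_ ^+ _ * _).
  by rewrite -subSS size_ys.
have detD : \det D = \prod_(i < k) \prod_(j < k | (i < j)%N) (y i - y j).
  have nzV : \prod_(i < k) \prod_(j < k | (i < j)%N) (y j - y i) != 0.
    apply/prodf_neq0 => i _; apply/prodf_neq0 => j lt_ij.
    by rewrite subr_eq0 (inj_eq inj_y) -val_eqE gtn_eqF.
  apply: (mulfI nzV); rewrite -det_powers -det_mulmx.
  (* Multiplying [D] by the Vandermonde matrix of [y] evaluates [Q j] at [y a], which gives 0 unless
     a = j. The diagonal entries then split into the factors with h > a and those with h < a. *)
  rewrite (_ : _ *m D = diag_mx (\row_a \prod_(h | h != a) (y a - y h))).
    rewrite det_diag det_powers.
    under eq_bigr => a _ do rewrite mxE (bigID (fun h : 'I_k => (a < h)%N)) /=.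
    rewrite big_split /= mulrC; congr (_ * _).
      rewrite !pair_big_dep /=.
      rewrite (reindex_inj (h := fun p : 'I_k * 'I_k => (p.2, p.1))) /=.
        apply: eq_bigl => -[i j] /=; rewrite -leqNgt ltn_neqAle.
        by rewrite -val_eqE.
      by move=> [a b] [c d] [-> ->].
    apply: eq_bigr => i _; apply: eq_bigl => j.
    by case: ltnP => [lt_ij|]; rewrite ?andbF // -val_eqE gtn_eqF.
  apply/matrixP=> a j; rewrite !mxE.
  transitivity (Q j).[y a].
    rewrite (horner_coef_wide _ (n := k)) ?size_Q //.
    by apply: eq_bigr => s _; rewrite !mxE mulrC.
  rewrite horner_prod; under eq_bigr do rewrite hornerXsubC.
  case: eqVneq => [-> | ne_aj]; first by rewrite mulr1n.
  by rewrite mulr0n (bigD1 a) //= subrr mul0r.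
rewrite defP det_mulmx detD det_revpowers -!big_split /=.
apply: eq_bigr => i _; rewrite -!big_split /=; apply: eq_bigr => j _.
by rewrite -mulrNN !opprB.
Qed.

End Cauchy.

Definition increasing k (l : {ffun 'I_k -> nat}) : bool :=
  [forall i : 'I_k, forall j : 'I_k, (i < j)%N ==> (l i < l j)%N].

Lemma increasing_lt k (l : {ffun 'I_k -> nat}) : increasing l ->
  forall i j : 'I_k, (l i < l j)%N = (i < j)%N.
Proof.
move=> inc_l i j; have lt_l (a b : 'I_k) : (a < b)%N -> (l a < l b)%N.
  by move/forallP/(_ a)/forallP/(_ b)/implyP: inc_l.
case: (ltngtP i j) => [/lt_l -> // | /lt_l lt_ji | /val_inj ->].
  by rewrite ltnNge ltnW.
by rewrite ltnn.
Qed.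

Lemma card_lt_increasing k (l : {ffun 'I_k -> nat}) (i : 'I_k) : increasing l ->
  #|[set j | (l j < l i)%N]| = i.
Proof.
move=> inc_l; have inj_w : injective (widen_ord (ltnW (ltn_ord i))).
  by move=> a b /(congr1 val) /= /val_inj.
rewrite -[RHS]card_ord -[RHS](card_imset _ inj_w).
congr #|pred_of_set _|; apply/setP=> j; rewrite inE increasing_lt //.
apply/idP/imsetP=> [lt_ji | [h _ ->] /=]; last exact: ltn_ord.
by exists (Ordinal lt_ji) => //; apply: val_inj.
Qed.

(** In an increasing tuple an index is the number of smaller entries, and a permutation of the
    entries preserves that number. *)
Lemma increasing_perm_eq k (l m : {ffun 'I_k -> nat}) (u : {perm 'I_k}) :
  increasing l -> increasing m -> (forall i, m (u i) = l i) -> u = 1%g.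
Proof.
move=> inc_l inc_m def_l; apply/permP=> i; rewrite perm1; apply: ord_inj.
rewrite -(card_lt_increasing i inc_l) -(card_lt_increasing (u i) inc_m).
rewrite -[RHS](card_imset _ (@perm_inj _ u)).
congr #|pred_of_set _|; apply/setP=> j; rewrite inE def_l.
apply/idP/imsetP=> [lt_j | [h + ->]]; last by rewrite inE def_l.
by exists (u^-1%g j); rewrite ?permKV // inE -def_l permKV.
Qed.

(** * Coefficient extraction from Cauchy's kernel *)

Section Coefficients.

Variables (k N : nat) (l m : {ffun 'I_k -> nat}).

Local Notation R := {mpoly int[k + k]}.
Let x i : R := 'X_(lshift k i).
Let y i : R := 'X_(rshift k i).

Definition mnm2 (a b : 'I_k -> nat) : 'X_{1..k + k} :=
  [multinom match split h with inl i => a i | inr j => b j end | h < k + k].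

Lemma mpolyX2 a b :
  \prod_i x i ^+ a i * \prod_j y j ^+ b j = 'X_[mnm2 a b] :> R.
Proof.
rewrite mpolyXE_id big_split_ord /=; congr (_ * _); apply: eq_bigr => i _.
  by rewrite mnmE (unsplitK (inl i)).
by rewrite mnmE (unsplitK (inr i)).
Qed.

Lemma mnm2_eq a b c d :
  (mnm2 a b == mnm2 c d) = [forall i, a i == c i] && [forall j, b j == d j].
Proof.
apply/eqP/andP=> [/mnmP eq_m | [/forallP eq_ac /forallP eq_bd]].
  split; apply/forallP=> i; apply/eqP.
    by have := eq_m (lshift k i); rewrite !mnmE (unsplitK (inl i)).
  by have := eq_m (rshift k i); rewrite !mnmE (unsplitK (inr i)).
apply/mnmP=> h; rewrite !mnmE; case: (split h) => i; apply/eqP.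
  exact: eq_ac.
exact: eq_bd.
Qed.

Let mu := mnm2 l m.

(** Every monomial of the correction term has exponent at least [N] in [x i], whereas [mu] has only
    [l i < N]. *)
Lemma mcoeff_high_power (p q : R) i : (l i < N)%N ->
  (p * (1 - x i ^+ N * q))@_mu = p@_mu.
Proof.
move=> lt_lN; rewrite mulrBr mulr1 mcoeffB mulrCA; set r := p * q.
rewrite [r]mpolyE mulr_sumr raddf_sum /= big1 ?subr0 // => h _.
rewrite -scalerAr mcoeffZ /x mpolyXn -mpolyXD mcoeffX.
case: eqP => [/mnmP/(_ (lshift k i))|_]; last by rewrite mulr0.
rewrite !mnmE (unsplitK (inl i)) /= => def_l.
suff /leq_ltn_trans/(_ lt_lN) : (N <= l i)%N by rewrite ltnn.
by rewrite -def_l mulmnE mnm1E eqxx mul1n leq_addr.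
Qed.

(** The series 1/(1 - z) truncated at degree [N], so that all computations stay among
    polynomials. *)
Definition geom (z : R) : R := \sum_(t < N) z ^+ t.

Lemma geomE z : (1 - z) * geom z = 1 - z ^+ N.
Proof. by rewrite /geom -[1 - z]opprB mulNr -subrX1 opprB. Qed.

(** A choice of one term in each geometric sum is an exponent matrix [c]: its row sums are the
    exponents of the [x i] and its column sums those of the [y j], while the two determinants add
    [w] and [v]. *)
Lemma mcoeff_kernel_expansion :
  (\det (\matrix_(i, j) x i ^+ j) * \det (\matrix_(i, j) y i ^+ j)
     * \prod_(p : 'I_k * 'I_k) geom (x p.1 * y p.2))@_mu
    = \sum_(w : 'S_k) \sum_(v : 'S_k) (-1) ^+ w * (-1) ^+ v
       * #|[set c : {ffun 'I_k * 'I_k -> 'I_N} |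
             [forall i, (\sum_j c (i, j) + w i)%N == l i]
             && [forall j, (\sum_i c (i, j) + v j)%N == m j]]|%:R.
Proof.
rewrite /geom bigA_distr_bigA /determinant /=.
rewrite mulr_suml mulr_suml raddf_sum; apply: eq_bigr => w _.
rewrite -mulrA mulr_suml mulr_sumr raddf_sum; apply: eq_bigr => v _.
rewrite mulrA mulr_sumr raddf_sum -sum1_card natr_sum mulr_sumr /= [RHS]big_mkcond.
apply: eq_bigr => c _; rewrite inE.
have mxE2 (z : 'I_k -> R) (s : 'S_k) :
    \prod_i (\matrix_(i, j) z i ^+ j) i (s i) = \prod_i z i ^+ s i.
  by apply: eq_bigr => i _; rewrite mxE.
rewrite !mxE2; pose row (i : 'I_k) := (\sum_j c (i, j))%N.
pose col (j : 'I_k) := (\sum_i c (i, j))%N.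
have -> : \prod_p (x p.1 * y p.2) ^+ c p
           = \prod_i x i ^+ row i * \prod_j y j ^+ col j.
  under eq_bigr do rewrite exprMn.
  rewrite big_split /=; congr (_ * _).
    transitivity (\prod_i \prod_j x i ^+ c (i, j)).
      by rewrite pair_big; apply: eq_bigr => -[].
    by apply: eq_bigr => i _; rewrite prodrXr.
  transitivity (\prod_j \prod_i y j ^+ c (i, j)).
    by rewrite exchange_big pair_big; apply: eq_bigr => -[].
  by apply: eq_bigr => j _; rewrite prodrXr.
transitivity (((-1) ^+ w * (-1) ^+ v
   *: 'X_[mnm2 (fun i => row i + w i)%N (fun j => col j + v j)%N]) @_mu : int).
  congr mcoeff; rewrite -mpolyX2 -mul_mpolyC.
  have splitX (z : 'I_k -> R) (a : 'I_k -> nat) (s : 'S_k) :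
      \prod_i z i ^+ (a i + s i) = \prod_i z i ^+ a i * \prod_i z i ^+ s i.
    by rewrite -big_split; apply: eq_bigr => i _; rewrite exprD.
  rewrite !splitX rmorphM !rmorph_sign.
  have shuffle (S : comPzRingType) (e1 e2 a b r s : S) :
    e1 * a * (e2 * b) * (r * s) = e1 * e2 * (r * a * (s * b)) by ring.
  exact: shuffle.
rewrite mcoeffZ mcoeffX mnm2_eq.
by case: ifP; rewrite ?mulr0.
Qed.

(** In this product [x i] and [y (u i)] always carry the same exponent, so only the choice t = l can
    reach [mu]. *)
Lemma mcoeff_diagonal (u : 'S_k) : (forall i, l i < N)%N ->
  (\prod_i geom (x i * y (u i)))@_mu = [forall i, m (u i) == l i]%:R.
Proof.
move=> lt_lN; rewrite /geom bigA_distr_bigA raddf_sum /=.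
pose t0 := [ffun i => Ordinal (lt_lN i)].
have E (t : {ffun 'I_k -> 'I_N}) : \prod_i (x i * y (u i)) ^+ t i
    = 'X_[mnm2 (fun i => t i) (fun j => t (u^-1%g j))].
  under eq_bigr do rewrite exprMn.
  rewrite -mpolyX2 big_split /=; congr (_ * _).
  rewrite [RHS](reindex_inj (@perm_inj _ u)) /=.
  by apply: eq_bigr => i _; rewrite permK.
under eq_bigr do rewrite E mcoeffX mnm2_eq.
rewrite (bigD1 t0) //= big1 ?addr0 => [|t /eqP ne_t].
  congr (nat_of_bool _)%:R; apply/andP/forallP=> [[_ /forallP eq_m] i | eq_m].
    by have := eq_m (u i); rewrite permK ffunE eq_sym.
  split; apply/forallP=> i; rewrite !ffunE //=.
  by have := eq_m (u^-1%g i); rewrite permKV eq_sym.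
case: forallP => //= eq_t; case: ne_t; apply/ffunP=> i.
by apply: ord_inj; rewrite ffunE /=; apply/eqP.
Qed.

(** By [det_cauchy] the two Vandermonde determinants become a sum over [u]. In the term of [u] every
    factor 1 - x_i y_h with h <> u i cancels its geometric sum up to a high power, which leaves the
    product of [mcoeff_diagonal]; monotonicity then allows only u = 1 and l = m. *)
Lemma sum_sign_margins : increasing l -> increasing m -> (forall i, l i < N)%N ->
  \sum_(w : 'S_k) \sum_(v : 'S_k) (-1) ^+ w * (-1) ^+ v
    * #|[set c : {ffun 'I_k * 'I_k -> 'I_N} |
          [forall i, (\sum_j c (i, j) + w i)%N == l i]
          && [forall j, (\sum_i c (i, j) + v j)%N == m j]]|%:R
  = (l == m)%:R :> int.
Proof.
move=> inc_l inc_m lt_lN; rewrite -mcoeff_kernel_expansion !det_powers.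
have inj_y : injective y.
  move=> i j /(congr1 (mcoeff U_(rshift k i))); rewrite !mcoeffXU eqxx eq_rshift.
  by rewrite eq_sym; case: eqP.
rewrite -det_cauchy // /determinant mulr_suml raddf_sum /=.
have termE (u : 'S_k) : ((-1) ^+ u
      * \prod_i (\matrix_(i, j) \prod_(h | h != j) (1 - x i * y h)) i (u i)
      * \prod_p geom (x p.1 * y p.2))@_mu
    = (-1) ^+ u * [forall i, m (u i) == l i]%:R.
  rewrite -(mcoeff_diagonal u lt_lN) -mulrA -[(-1) ^+ u in LHS](rmorph_sign (@mpolyC _ _)).
  rewrite mul_mpolyC mcoeffZ; congr (_ * _).
  rewrite -(pair_bigA _ (fun i j => geom (x i * y j))) -big_split /=.
  transitivity ((\prod_i geom (x i * y (u i))
     * \prod_i \prod_(h | h != u i) (1 - (x i * y h) ^+ N))@_mu).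
    congr mcoeff; rewrite -big_split; apply: eq_bigr => i _; rewrite mxE /=.
    rewrite [X in _ * X](bigD1 (u i)) //= mulrCA -big_split; congr (_ * _).
    by apply: eq_bigr => h _; rewrite /= geomE.
  (* The leftover factors 1 - (x_i y_h)^N do not affect the coefficient at [mu], a property closed
     under products. *)
  set p := \prod_i _; move: p; pose inert q := forall p : R, (p * q)@_mu = p@_mu.
  have inert1 : inert 1 by move=> p; rewrite mulr1.
  have inertM a b : inert a -> inert b -> inert (a * b).
    by move=> inert_a inert_b p; rewrite mulrA inert_b inert_a.
  apply: (big_ind inert) => // i _; apply: (big_ind inert) => // h _ p.
  by rewrite exprMn mcoeff_high_power.
rewrite (eq_bigr _ (fun u _ => termE u)).
have [eq_lm | ne_lm] := eqVneq l m.
  rewrite (bigD1 1%g) //= odd_perm1 mul1r big1 ?addr0 => [|u].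
    by case: forallP => // -[] i; rewrite perm1 eq_lm.
  case: forallP => [def_l /negP[]|_]; last by rewrite mulr0.
  apply/eqP; apply: (increasing_perm_eq inc_l inc_m) => i.
  exact/eqP/def_l.
apply: big1 => u _; case: forallP => [def_l|_]; last by rewrite mulr0.
case/eqP: ne_lm; apply/ffunP=> i.
have u1 : u = 1%g.
  by apply: (increasing_perm_eq inc_l inc_m) => j; apply/eqP/def_l.
by have /eqP <- := def_l i; rewrite u1 perm1.
Qed.

End Coefficients.

(** * Frobenius characters *)

Section SymChar.

Variables n k : nat.
Implicit Types (l m : {ffun 'I_k -> nat}) (s : {perm 'I_n}) (w : 'S_k).

Definition beta_set l : bool :=
  increasing l && (\sum_i l i == n + \sum_(i < k) i)%N.

Let N := (n + \sum_(i < k) i)%N.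
Let le_nN : (n <= N)%N. Proof. exact: leq_addr. Qed.

Lemma beta_set_bound l : beta_set l -> forall i, (l i < N.+1)%N.
Proof.
by case/andP=> _ /eqP sum_l i; rewrite ltnS /N -sum_l (bigD1 i) //= leq_addr.
Qed.

Definition shifted_words l w : {set {ffun 'I_n -> 'I_k}} :=
  [set f | [forall i, (letters f i + w i)%N == l i]].

Definition symcharZ l s : int :=
  \sum_(w : 'S_k) (-1) ^+ w * #|[set f in shifted_words l w | permw f s == f]|%:R.

(** Grouping the words by content writes Frobenius' formula as an integer combination of permutation
    characters, hence as a virtual character. *)
Definition symchar l : 'CF('Sym_('I_n)) :=
  \sum_(w : 'S_k) (-1) ^+ w
     *: \sum_(c : {ffun 'I_k -> 'I_N.+1} | [forall i, (c i + w i)%N == l i])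
          wordchar n c.

Lemma symcharE l s : symchar l s = (symcharZ l s)%:~R.
Proof.
rewrite sum_cfunE rmorph_sum; apply: eq_bigr => w _.
rewrite cfunE rmorphM rmorph_sign rmorph_nat; congr (_ * _).
rewrite sum_cfunE; under eq_bigr do rewrite wordcharE.
rewrite -natr_sum -[in RHS]sum1_card; congr _%:R.
rewrite [RHS](partition_big (@content n N _) (fun c => [forall i, (c i + w i)%N == l i])) /=.
  apply: eq_bigr => c /forallP def_c; rewrite -sum1dep_card; apply: eq_bigl => f.
  rewrite !inE; case: (content N f =P c) => [def_f|]; rewrite ?andbF // !andbT.
  apply/esym/andb_idl => _; apply/forallP=> i.
  by rewrite -(contentE le_nN) def_f.
move=> f; rewrite !inE => /andP[/forallP def_f _]; apply/forallP=> i.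
by rewrite contentE.
Qed.

Lemma letters_fst (h : {ffun 'I_n -> 'I_k * 'I_k}) i :
  letters [ffun a => (h a).1] i = (\sum_j letters h (i, j))%N.
Proof.
rewrite /letters -sum1dep_card (partition_big (fun a => (h a).2) xpredT) //=.
apply: eq_bigr => j _; rewrite -sum1dep_card; apply: eq_bigl => a.
by rewrite ffunE; case: (h a).
Qed.

Lemma letters_snd (h : {ffun 'I_n -> 'I_k * 'I_k}) j :
  letters [ffun a => (h a).2] j = (\sum_i letters h (i, j))%N.
Proof.
rewrite /letters -sum1dep_card (partition_big (fun a => (h a).1) xpredT) //=.
apply: eq_bigr => i _; rewrite -sum1dep_card; apply: eq_bigl => a.
by rewrite ffunE andbC; case: (h a).
Qed.

Lemma symchar_vchar l : symchar l \in 'Z[irr 'Sym_('I_n)].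
Proof.
apply: rpred_sum => w _; rewrite rpredZsign rpred_sum // => c _.
exact/char_vchar/cfRepr_char.
Qed.

(** A product of two word counts becomes a single count of words over pairs of letters, whose
    content is a k by k matrix. *)
Lemma card_pair_words (A B : {set {ffun 'I_n -> 'I_k}}) :
  (#|A| * #|B|
    = #|[set h : {ffun 'I_n -> 'I_k * 'I_k} |
          ([ffun a => (h a).1] \in A) && ([ffun a => (h a).2] \in B)]|)%N.
Proof.
pose u (p : {ffun 'I_n -> 'I_k} * {ffun 'I_n -> 'I_k}) := [ffun a => (p.1 a, p.2 a)].
have inj_u : injective u.
  move=> [f g] [f' g'] /ffunP eq_u.
  by congr (_, _); apply/ffunP=> a; have := eq_u a; rewrite !ffunE => -[].
rewrite -cardsX -(card_imset _ inj_u); congr #|pred_of_set _|.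
apply/setP=> h; rewrite inE; apply/imsetP/andP=> [[[f g]]|[Ah Bh]].
  rewrite inE => /andP[/= Af Bg] ->.
  have <- : f = [ffun a => (u (f, g) a).1] by apply/ffunP=> a; rewrite !ffunE.
  by have <- : g = [ffun a => (u (f, g) a).2] by apply/ffunP=> a; rewrite !ffunE.
exists ([ffun a => (h a).1], [ffun a => (h a).2]); first by rewrite inE Ah Bh.
by apply/ffunP=> a; rewrite !ffunE -surjective_pairing.
Qed.

(** The margins of the content matrix of a pair word are the contents of its two components, so
    Burnside's lemma turns the sum over [s] into n! times the signed count of [sum_sign_margins]. *)
Lemma sum_symcharZ_mul l m : beta_set l -> beta_set m ->
  \sum_s symcharZ l s * symcharZ m s = (n`! * (l == m))%:R.
Proof.
move=> bl bm; have [inc_l /eqP sum_l] := andP bl; have [inc_m _] := andP bm.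
have lt_l := beta_set_bound bl.
rewrite natrM -(sum_sign_margins inc_l inc_m lt_l) mulr_sumr.
under eq_bigr do rewrite mulr_suml.
rewrite exchange_big; apply: eq_bigr => w _; rewrite mulr_sumr.
under eq_bigr do rewrite mulr_sumr.
rewrite exchange_big; apply: eq_bigr => v _ /=.
under eq_bigr do rewrite mulrACA -natrM card_pair_words.
rewrite -mulr_sumr -natr_sum mulrCA -natrM; congr (_ * _%:R).
pose P (c : {ffun 'I_k * 'I_k -> 'I_N.+1}) :=
  [forall i, (\sum_j c (i, j) + w i)%N == l i]
  && [forall j, (\sum_i c (i, j) + v j)%N == m j].
transitivity (\sum_(s : {perm 'I_n})
  #|[set h : {ffun 'I_n -> _} | (permw h s == h) && P (content N h)]|)%N.
  apply: eq_bigr => s _; congr #|pred_of_set _|; apply/setP=> h; rewrite !inE.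
  have fixE : (permw h s == h) = (permw [ffun a => (h a).1] s == [ffun a => (h a).1])
                               && (permw [ffun a => (h a).2] s == [ffun a => (h a).2]).
    apply/eqP/andP=> [def_h|[/eqP/ffunP fix1 /eqP/ffunP fix2]].
      by split; apply/eqP/ffunP=> a; rewrite !ffunE -[in RHS]def_h ffunE.
    apply/ffunP=> a; have := fix1 a; have := fix2 a; rewrite !ffunE.
    by case: (h a) (h _) => ? ? [? ?] /= -> ->.
  rewrite fixE /P; under eq_forallb do rewrite letters_fst.
  rewrite andbACA andbC; congr (_ && (_ && _)).
    apply: eq_forallb => i; congr (_ + _ == _)%N; apply: eq_bigr => j _.
    by rewrite contentE.
  apply: eq_forallb => j; rewrite letters_snd; congr (_ + _ == _)%N.
  by apply: eq_bigr => i _; rewrite contentE.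
rewrite sum_fixed_content //; congr (_ * #|pred_of_set _|)%N.
(* The entries of [c] sum to n automatically: the row sums l i - w i add up to n because [l] is a
   beta-set. *)
apply/setP=> c; rewrite !inE; apply: andb_idl => /andP[/forallP eq_l _].
rewrite -(eqn_add2r (\sum_(i < k) i)) -[X in _ == X]sum_l; apply/eqP.
under [RHS]eq_bigr do rewrite -(eqP (eq_l _)).
rewrite big_split /= pair_big /=; congr (_ + _)%N.
  by apply: eq_bigr => -[].
by rewrite (reindex_inj (@perm_inj _ w)).
Qed.
End SymChar.

(** * Multinomial coefficients and determinants of falling factorials *)

Section Multinomial.

Variable T : finType.

Definition consw n (x : T) (g : {ffun 'I_n -> T}) : {ffun 'I_n.+1 -> T} :=
  [ffun i => if unlift ord0 i is Some j then g j else x].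

Lemma letters_consw n x (g : {ffun 'I_n -> T}) y :
  letters (consw x g) y = ((x == y) + letters g y)%N.
Proof.
rewrite /letters -!sum1dep_card big_mkcond [in RHS]big_mkcond big_ord_recl /=.
rewrite ffunE unlift_none; congr (_ + _)%N.
by apply: eq_bigr => i _; rewrite ffunE liftK.
Qed.

Lemma card_words_letters n (a : T -> nat) : (\sum_x a x = n)%N ->
  (#|[set f : {ffun 'I_n -> T} | [forall x, letters f x == a x]]|
     * \prod_x (a x)`! = n`!)%N.
Proof.
elim: n a => [|n IHn] a sum_a.
  have a0 x : a x = 0%N.
    by apply/eqP; rewrite -leqn0 -sum_a (bigD1 x) //= leq_addr.
  rewrite big1 ?muln1 => [|x _]; last by rewrite a0.
  rewrite (_ : [set _ | _] = setT) ?cardsT ?card_ffun ?card_ord //.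
  apply/setP=> f; rewrite !inE; apply/forallP=> x.
  by rewrite a0 -leqn0 -[leqRHS](sum_letters f) (bigD1 x) //= leq_addr.
set S := [set f | _].
(* Removing the first letter [x] leaves a word with one [x] fewer, to which the induction hypothesis
   applies; summing over [x] then gives (n + 1) n!. *)
have cardS x : (#|[set f in S | f ord0 == x]| * \prod_y (a y)`! = a x * n`!)%N.
  case a_x: (a x) => [|ax].
    rewrite mul0n (_ : [set _ in _ | _] = set0) ?cards0 ?mul0n //.
    apply/setP=> f; rewrite !inE; apply/negP=> /andP[/forallP/(_ x)].
    rewrite a_x cards_eq0 => /eqP/setP/(_ ord0); rewrite !inE => ->.
    by [].
  pose b y := (a y - (x == y))%N.
  have aE y : a y = ((x == y) + b y)%N.
    by rewrite /b; case: eqP => [<- | _]; rewrite ?subn0 // a_x subn1.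
  have sum_b : (\sum_y b y = n)%N.
    apply: succn_inj; rewrite -sum_a; under [RHS]eq_bigr do rewrite aE.
    rewrite big_split /= -add1n; congr (_ + _)%N.
    rewrite (bigD1 x) //= eqxx big1 ?addn0 // => y /negPf.
    by rewrite eq_sym => ->.
  have prod_a : (\prod_y (a y)`! = a x * \prod_y (b y)`!)%N.
    have b_x : b x = ax by rewrite /b eqxx a_x subn1.
    rewrite (bigD1 x) // [in RHS](bigD1 x) //= a_x b_x factS -mulnA.
    congr (_ * (_ * _))%N.
    by apply: eq_bigr => y /negPf ne_y; rewrite /b eq_sym ne_y subn0.
  have inj_cons : injective (@consw n x).
    move=> g h /ffunP eq_gh; apply/ffunP=> i.
    by have := eq_gh (lift ord0 i); rewrite !ffunE liftK.
  rewrite -a_x -(IHn b sum_b) prod_a mulnCA; congr (_ * (_ * _))%N.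
  rewrite -(card_imset _ inj_cons); congr #|pred_of_set _|.
  apply/setP=> f; rewrite !inE; apply/andP/imsetP=> [[/forallP af /eqP f0]|].
    have def_f : f = consw x [ffun i => f (lift ord0 i)].
      apply/ffunP=> i; rewrite ffunE; case: unliftP => [j ->|->] //.
      by rewrite ffunE.
    exists [ffun i => f (lift ord0 i)] => //; rewrite inE; apply/forallP=> y.
    by have := af y; rewrite {1}def_f letters_consw aE eqn_add2l.
  case=> g; rewrite inE => /forallP bg ->; split; last first.
    by rewrite ffunE unlift_none.
  by apply/forallP=> y; rewrite letters_consw aE eqn_add2l.
transitivity (\sum_x #|[set f in S | f ord0 == x]| * \prod_y (a y)`!)%N.
  rewrite -big_distrl /=; congr (_ * _)%N.
  rewrite -sum1_card (partition_big (fun f : {ffun _ -> T} => f ord0) xpredT) //=.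
  apply: eq_bigr => x _; rewrite -sum1_card.
  by apply: eq_bigl => f; rewrite !inE.
by under eq_bigr do rewrite cardS; rewrite -big_distrl /= sum_a factS.
Qed.

End Multinomial.

Lemma horner_ffact (R : comNzRingType) a j :
  (\prod_(t < j) ('X - t%:R%:P)).[a%:R] = (a ^_ j)%:R :> R.
Proof.
elim: j => [|j IHj]; first by rewrite big_ord0 hornerC.
rewrite big_ord_recr hornerM IHj hornerXsubC ffactnSr natrM.
case: (leqP j a) => [le_ja | lt_aj]; first by rewrite natrB.
by rewrite ffact_small ?mul0r.
Qed.

(** The falling factorials are monic of degree j, so the passage from powers to them is
    unitriangular. *)
Lemma det_ffact (R : comNzRingType) k (l : 'I_k -> nat) :
  \det (\matrix_(i, j) (l i ^_ j)%:R)
    = \prod_(i < k) \prod_(j < k | (i < j)%N) ((l j)%:R - (l i)%:R) :> R.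
Proof.
pose p j : {poly R} := \prod_(t < j) ('X - t%:R%:P).
have size_p j : size (p j) = j.+1.
  by rewrite size_prod_XsubC -[index_enum _]enumT size_enum_ord.
pose U := \matrix_(s < k, j < k) (p j)`_s.
have detU : \det U = 1.
  rewrite -det_tr det_trig => [|]; last first.
    apply/is_trig_mxP => j s lt_js; rewrite !mxE nth_default //.
    by rewrite size_p.
  apply: big1 => j _; rewrite !mxE.
  have := monicP (monic_prod_XsubC (index_enum 'I_j) xpredT (fun t => t%:R : R)).
  by rewrite lead_coefE -/(p j) size_p.
rewrite -det_powers -[RHS]mulr1 -[X in _ * X]detU -det_mulmx; congr (\det _).
apply/matrixP=> i j; rewrite !mxE.
transitivity (p j).[(l i)%:R]; first by rewrite horner_ffact.
rewrite (horner_coef_wide _ (n := k)); last by rewrite -/(p j) size_p.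
by apply: eq_bigr => s _; rewrite !mxE mulrC.
Qed.

(** * Degrees and irreducibility of the Frobenius characters *)

Section SymCharDegree.

Variables n k : nat.
Implicit Types (l m : {ffun 'I_k -> nat}) (w : 'S_k).

(** The count is the multinomial coefficient n! / prod (l i - w i)!. If some w i > l i there are no
    such words, and the falling factorial vanishes as well. *)
Lemma card_shifted_words l w : beta_set n l ->
  (#|shifted_words n l w| * \prod_i (l i)`! = n`! * \prod_i (l i ^_ w i))%N.
Proof.
case/andP=> _ /eqP sum_l.
have [/forallP le_wl | /forallPn[i]] := boolP [forall i, (w i <= l i)%N]; last first.
  rewrite -ltnNge => lt_lw; rewrite [in RHS](bigD1 i) //= ffact_small // mul0n muln0.
  rewrite (_ : shifted_words n l w = set0) ?cards0 //.
  apply/setP=> f; rewrite !inE; apply/negP=> /forallP/(_ i)/eqP def_li.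
  by rewrite -def_li ltnNge leq_addl in lt_lw.
pose a i := (l i - w i)%N.
have sum_a : (\sum_i a i)%N = n.
  apply/eqP; rewrite -(eqn_add2r (\sum_(i < k) i)) -sum_l.
  rewrite [X in (_ + X)%N](reindex_inj (@perm_inj _ w)) -big_split /=.
  by apply/eqP/eq_bigr => i _; rewrite subnK.
rewrite -(card_words_letters sum_a) -mulnA -big_split /=.
under [X in (_ * X)%N = _]eq_bigr do rewrite -(ffact_fact (le_wl _)) mulnC.
congr (_ * _)%N; congr #|pred_of_set _|; apply/setP=> f; rewrite !inE.
by apply: eq_forallb => i; rewrite -[in LHS](subnK (le_wl i)) eqn_add2r.
Qed.

Lemma symcharZ_degree l : beta_set n l ->
  symcharZ l (1%g : {perm 'I_n}) * (\prod_i (l i)`!)%:R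
    = n`!%:R * \prod_(i < k) \prod_(j < k | (i < j)%N) ((l j)%:R - (l i)%:R).
Proof.
move=> bl; rewrite -det_ffact /determinant mulr_suml mulr_sumr.
apply: eq_bigr => w _; rewrite -mulrA -natrM mulrCA; congr (_ * _).
rewrite (_ : [set f in _ | _] = shifted_words n l w); last first.
  by apply/setP=> f; rewrite inE permw1 eqxx andbT.
rewrite card_shifted_words // natrM natr_prod; congr (_ * _).
by apply: eq_bigr => i _; rewrite mxE.
Qed.

Lemma symcharZ_degree_gt0 l : beta_set n l ->
  0 < symcharZ l (1%g : {perm 'I_n}).
Proof.
move=> bl; have [inc_l _] := andP bl.
have prod_gt0 : 0 < (\prod_i (l i)`!)%:R :> int.
  by rewrite ltr0n prodn_gt0 // => i; rewrite fact_gt0.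
rewrite -(pmulr_lgt0 _ prod_gt0) symcharZ_degree // mulr_gt0 //.
  by rewrite ltr0n fact_gt0.
apply: prodr_gt0 => i _; apply: prodr_gt0 => j lt_ij.
by rewrite subr_gt0 ltr_nat increasing_lt.
Qed.

Lemma symchar_dot l m : beta_set n l -> beta_set n m ->
  '[symchar n l, symchar n m] = (l == m)%:R.
Proof.
move=> bl bm; rewrite cfdotE.
under eq_bigr do rewrite !symcharE rmorph_int -intrM.
rewrite (eq_bigl xpredT) => [|s]; last by rewrite inE.
rewrite -rmorph_sum /= sum_symcharZ_mul // cardsT card_Sn.
rewrite rmorph_nat natrM mulKf // pnatr_eq0 -lt0n.
exact: fact_gt0.
Qed.

(** A virtual character of norm 1 is an irreducible character up to sign, and the positive degree
    settles the sign. *)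
Lemma symchar_irr l : beta_set n l -> symchar n l \in irr 'Sym_('I_n).
Proof.
move=> bl; have norm1 : '[symchar n l] = 1 by rewrite symchar_dot ?eqxx.
have [[] [i def_i]] := vchar_norm1P (symchar_vchar n l) norm1; last first.
  by rewrite def_i scale1r mem_irr.
have := symcharZ_degree_gt0 bl; rewrite -(ltr0z algC) -symcharE def_i.
by rewrite cfunE mulN1r oppr_gt0 lt_gtF ?irr1_gt0.
Qed.

End SymCharDegree.

(** * Twisting by the sign *)

Section Sign.

Variable n : nat.

Definition signmx (s : {perm 'I_n}) : 'M[algC]_1 := ((-1) ^+ s)%:M.

Lemma signmx_repr : mx_repr 'Sym_('I_n) signmx.
Proof.
split=> [|s t _ _]; first by rewrite /signmx odd_perm1.
by rewrite /signmx odd_permM signr_addb scalar_mxM.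
Qed.

Definition signchar : 'CF('Sym_('I_n)) := cfRepr (MxRepresentation signmx_repr).

Lemma signcharE (s : {perm 'I_n}) : signchar s = (-1) ^+ s.
Proof. by rewrite cfunE inE mulr1n /= mxtrace_scalar. Qed.

Lemma signchar_lin : signchar \is a linear_char.
Proof. by rewrite qualifE /= cfRepr_char signcharE odd_perm1 /=. Qed.

(** The transposition of [a] and [b] fixes both words, so multiplying by it pairs even with odd
    elements of the common stabilizer. *)
Lemma sum_sign_stab (T U : finType) (f : {ffun 'I_n -> T}) (g : {ffun 'I_n -> U})
    a b : a != b -> f a = f b -> g a = g b ->
  \sum_(s : {perm 'I_n} | (permw f s == f) && (permw g s == g)) (-1) ^+ s = 0 :> int.
Proof.
move=> ne_ab eq_f eq_g; pose t := tperm a b.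
have fixt (V : finType) (h : {ffun 'I_n -> V}) : h a = h b -> permw h t = h.
  by move=> eq_h; apply/ffunP=> c; rewrite ffunE; case: tpermP => // ->.
have fixM (V : finType) (h : {ffun 'I_n -> V}) s :
    h a = h b -> (permw h (t * s)%g == h) = (permw h s == h).
  move=> /fixt ht; rewrite permwM; apply/eqP/eqP=> [def_h | -> //].
  by rewrite -(permwK (permw h s) t) def_h tpermV ht.
set S := \sum_(s | _) _; suff : S = - S by lia.
rewrite {1}/S (reindex_inj (mulgI t)) /= -sumrN; apply: eq_big => s.
  by rewrite !fixM.
by rewrite odd_permM odd_tperm ne_ab signr_addb mulN1r.
Qed.

Variable k : nat.
Implicit Types (l m : {ffun 'I_k -> nat}).

(** The hypothesis says that the partition of [m] has at most [r] rows. It forces [w] to fix every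
    low index, which leaves no room for the corresponding letters. *)
Lemma letters_shifted_low m (w : 'S_k) g r (i : 'I_k) :
  (forall j : 'I_k, (j + r < k)%N -> m j = j) -> g \in shifted_words n m w ->
  (i + r < k)%N -> letters g i = 0%N.
Proof.
rewrite inE => low_m /forallP def_m.
suff w_id d : forall j : 'I_k, (j <= d)%N -> (j + r < k)%N -> w j = j.
  move=> lt_ik; have := def_m i; rewrite low_m // (w_id i) //.
  by rewrite -[X in _ == X]add0n eqn_add2r => /eqP.
elim: d => [|d IHd] j le_jd lt_jk.
  have := def_m j; rewrite low_m //; move: le_jd; rewrite leqn0 => /eqP j0.
  by rewrite [X in _ == X]j0 addn_eq0 => /andP[_ /eqP wj]; apply: ord_inj; rewrite wj j0.
have le_wj : (w j <= j)%N by have /eqP := def_m j; rewrite low_m // => <-; exact: leq_addl.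
apply: ord_inj; apply/eqP; rewrite eqn_leq le_wj leqNgt; apply/negP=> lt_wj.
(* If w j < j, the induction hypothesis says that [w] fixes w j, and injectivity yields w j = j. *)
suff /perm_inj eq_wj : w (w j) = w j by rewrite [in X in (X < _)%N]eq_wj ltnn in lt_wj.
apply: IHd; first by rewrite -ltnS (leq_trans lt_wj).
by apply: leq_ltn_trans lt_jk; rewrite leq_add2r.
Qed.

Lemma card_high_ord r : (#|[set i : 'I_k | k <= i + r]| <= r)%N.
Proof.
rewrite cardE -(size_map val) -[leqRHS](size_iota (k - r)).
apply: uniq_leq_size => [|_ /mapP[i + ->]].
  by rewrite map_inj_uniq ?enum_uniq //; apply: val_inj.
by rewrite mem_enum inE mem_iota => le_k; have := ltn_ord i => /=; lia.
Qed.

(** The norm sum of [symcharZ l] is n!. Expanding one of its two factors over words writes it as a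
    signed sum of these stabilizer sums, so they cannot all vanish. *)
Lemma exists_stab_sum_neq0 l : beta_set n l ->
  exists (w : 'S_k) (f : {ffun 'I_n -> 'I_k}), f \in shifted_words n l w
    /\ \sum_(s | permw f s == f) symcharZ l s != 0.
Proof.
move=> bl; have := sum_symcharZ_mul bl bl; rewrite eqxx muln1 => sum_ll.
have: \sum_(s : {perm 'I_n}) symcharZ l s * symcharZ l s != 0.
  by rewrite sum_ll pnatr_eq0 -lt0n fact_gt0.
move=> nz; suff /existsP[w /existsP[f /andP[]]] :
    [exists w : 'S_k, exists f : {ffun 'I_n -> 'I_k},
       (f \in shifted_words n l w) && (\sum_(s | permw f s == f) symcharZ l s != 0)].
  by exists w, f.
apply: contraNT nz => no_f; apply/eqP.
under eq_bigr do rewrite {2}/symcharZ mulr_sumr.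
rewrite exchange_big big1 //= => w _.
under eq_bigr do rewrite mulrCA -sum1_card natr_sum mulr_sumr.
rewrite -mulr_sumr; apply/eqP; rewrite mulf_eq0 signr_eq0 /=; apply/eqP.
under eq_bigr do under eq_bigl do rewrite inE.
rewrite (exchange_big_dep (mem (shifted_words n l w))) /=; last first.
  by move=> s f _ /andP[].
apply: big1 => f lf; apply/eqP; apply: contraNT no_f => nz_f.
apply/existsP; exists w; apply/existsP; exists f; rewrite lf /=.
apply: contraNneq nz_f => sum0; rewrite -[X in _ == X]sum0.
by apply/eqP/eq_big => s; [rewrite lf | rewrite mulr1].
Qed.

(** A word contributing to [m] uses at most [r] letters, so by pigeonhole it repeats a letter on a
    fibre of [f] with more than [r] points, and [sum_sign_stab] applies. *)
Lemma sum_sign_symcharZ m r (f : {ffun 'I_n -> 'I_k}) i :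
  (forall j : 'I_k, (j + r < k)%N -> m j = j) -> (r < letters f i)%N ->
  \sum_(s | permw f s == f) (-1) ^+ s * symcharZ m s = 0.
Proof.
move=> low_m lt_rf; under eq_bigr do rewrite mulr_sumr.
rewrite exchange_big big1 //= => w _.
under eq_bigr do rewrite mulrCA -sum1_card natr_sum mulr_sumr.
rewrite -mulr_sumr; apply/eqP; rewrite mulf_eq0 signr_eq0 /=; apply/eqP.
under eq_bigr do under eq_bigl do rewrite inE.
rewrite (exchange_big_dep (mem (shifted_words n m w))) /=; last first.
  by move=> s g _ /andP[].
apply: big1 => g mg.
have: ~~ dinjectiveb g [set a | f a == i].
  apply: contraTN lt_rf => /dinjectiveP inj_g; rewrite -leqNgt /letters.
  rewrite -(card_in_imset inj_g) (leq_trans _ (card_high_ord r)) //.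
  apply/subset_leq_card/subsetP=> _ /imsetP[a _ ->]; rewrite inE leqNgt.
  apply/negP=> /(letters_shifted_low low_m mg)/eqP.
  by rewrite cards_eq0 => /eqP/setP/(_ a); rewrite !inE eqxx.
case/dinjectivePn=> a fa [b /andP[ne_ba fb] eq_g].
rewrite !inE in fa fb.
rewrite -[RHS](@sum_sign_stab _ _ f g a b) //; last first.
- by rewrite (eqP fa) (eqP fb).
- by rewrite eq_sym.
by apply: eq_big => s; [rewrite mg | rewrite mulr1].
Qed.

Lemma symchar_neq_sign l m r (i : 'I_k) : beta_set n l ->
  (k + r <= l i)%N -> (forall j : 'I_k, (j + r < k)%N -> m j = j) ->
  symchar n m != signchar * symchar n l.
Proof.
move=> bl long_l low_m; apply/eqP=> def_m.
have [w [f [lf /negP[]]]] := exists_stab_sum_neq0 bl.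
(* Since w i < k, the word [f] uses the letter [i] at least l i - k + 1 times. *)
have lt_rf : (r < letters f i)%N.
  move: lf; rewrite inE => /forallP/(_ i)/eqP def_li.
  rewrite -(leq_add2r (w i)) def_li; apply: leq_trans long_l.
  by rewrite addSnnS addnC leq_add2r.
apply/eqP; rewrite -[RHS](sum_sign_symcharZ low_m lt_rf); apply: eq_bigr => s _.
apply: (@intr_inj algC); rewrite rmorphM rmorph_sign /= -!symcharE def_m.
by rewrite cfunE signcharE mulrA -signr_addb addbb mul1r.
Qed.

End Sign.

(** * Restriction to the alternating group *)

Section Restriction.

Variable n : nat.
Hypothesis n_gt1 : (1 < n)%N.

(** The function chi + sgn chi is 2 chi on A_n and 0 elsewhere. As chi and sgn chi are orthogonal,
    pairing it with chi gives the restriction norm 1. *)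
Lemma cfRes_Alt_irr (chi : 'CF('Sym_('I_n))) :
  chi \in irr 'Sym_('I_n) -> chi != signchar n * chi ->
  'Res['Alt_('I_n)] chi \in irr 'Alt_('I_n).
Proof.
move=> irr_chi ne_chi; rewrite irrEchar.
have char_chi : chi \is a character by case/irrP: irr_chi => i ->; exact: irr_char.
rewrite cfRes_char //=.
have irr_sgn := mul_lin_irr (signchar_lin n) irr_chi.
have dot_sgn : '[signchar n * chi, chi] = 0.
  case/irrP: irr_sgn ne_chi => j ->; case/irrP: irr_chi => i ->.
  by rewrite (inj_eq irr_inj) cfdot_irr eq_sym => /negPf ->.
have norm_chi : '[chi] = 1 by move: irr_chi; rewrite irrEchar => /andP[_ /eqP].
have cardA : #|'Alt_('I_n)|%:R != 0 :> algC by rewrite pnatr_eq0 -lt0n cardG_gt0.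
have cardS : #|'Sym_('I_n)|%:R = 2 * #|'Alt_('I_n)|%:R :> algC.
  by rewrite -natrM card_Alt card_ord // cardsT card_Sn.
have nz2 : 2 != 0 :> algC by rewrite pnatr_eq0.
rewrite cfdotE; under eq_bigr => s As do rewrite cfResE ?Alt_subset //.
set X := \sum_(s in _) _; suff -> : X = #|'Alt_('I_n)|%:R by rewrite mulVf.
have sumS (phi : 'CF('Sym_('I_n))) :
    2 * #|'Alt_('I_n)|%:R * '[phi, chi] = \sum_s phi s * (chi s)^*.
  rewrite cfdotE cardS mulVKf ?mulf_neq0 //.
  by apply: eq_bigl => s; rewrite inE.
have sum0 : \sum_s (signchar n * chi) s * (chi s)^* = 0.
  by rewrite -sumS dot_sgn mulr0.
apply: (mulfI nz2); rewrite -[RHS]mulr1 -[X in _ = _ * X]norm_chi sumS.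
rewrite -[RHS]addr0 -[X in _ + X]sum0 -big_split /=.
rewrite /X big_mkcond mulr_sumr; apply: eq_bigr => s _.
rewrite Alt_even cfunE signcharE -mulrA.
by case: (odd_perm s); rewrite /= ?mulN1r ?subrr ?mulr0 // mul1r mulr_natl mulr2n.
Qed.

End Restriction.

Lemma same_degree_Alt_irr_le n j k :
  (j <= k)%N -> same_degree_Alt_irr n k -> same_degree_Alt_irr n j.
Proof.
move=> le_jk [S [cardS degS irrS]]; rewrite -cardS in le_jk.
exists [set i in take j (enum S)]; split.
- rewrite cardsE (card_uniqP _) ?take_uniq ?enum_uniq // size_takel //.
  by rewrite -cardE.
- by move=> i i'; rewrite !inE => /mem_take + /mem_take; rewrite !mem_enum; exact: degS.
- by move=> i; rewrite inE => /mem_take; rewrite mem_enum; exact: irrS.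
Qed.

Lemma same_degree_le_m n k : same_degree_Alt_irr n k -> (k <= m n)%N.
Proof.
move=> [S [<- degS _]]; have [-> | [i0 Si0]] := set_0Vmem S; first by rewrite cards0.
have := irr1_degree i0; set d := irr_degree _ => deg_i0.
apply: leq_trans (degree_mult_le_max 'Sym_('I_n) (d := d) _).
  apply/subset_leq_card/subsetP=> i Si.
  by rewrite inE (degS i i0) // deg_i0.
exact: irr_degree_gt0.
Qed.

(** * Doubling a family by the sign twist *)

Section SameDegree.

Variables (n k : nat) (L : seq {ffun 'I_k -> nat}).
Hypotheses (n_gt1 : (1 < n)%N) (uniq_L : uniq L).
Hypothesis beta_L : {in L, forall l, beta_set n l}.
Hypothesis deg_L : {in L &, forall l l', symchar n l 1%g = symchar n l' 1%g}.
Hypothesis sign_L :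
  {in L &, forall l l', symchar n l' != signchar n * symchar n l}.

Lemma signchar_mulK (phi : 'CF('Sym_('I_n))) : signchar n * (signchar n * phi) = phi.
Proof.
apply/cfunP=> s; rewrite cfunE [X in _ * X]cfunE signcharE mulrA -signr_addb addbb.
exact: mul1r.
Qed.

(** Each character is taken together with its sign twist. Hypothesis [sign_L] for l <> l' keeps the
    two halves disjoint; for l = l' it does so too and also makes the restrictions irreducible. *)
Lemma same_degree_of_beta_sets : same_degree_Alt_irr n (size L).*2.
Proof.
pose phis := [seq symchar n l | l <- L].
pose chars := phis ++ [seq signchar n * phi | phi <- phis].
have irr_phis : {subset phis <= irr 'Sym_('I_n)}.
  by move=> _ /mapP[l Ll ->]; apply/symchar_irr/beta_L.
have irr_chars : {subset chars <= irr 'Sym_('I_n)}.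
  move=> phi; rewrite mem_cat => /orP[/irr_phis // | /mapP[psi /irr_phis ? ->]].
  exact: mul_lin_irr (signchar_lin n) _.
have sgn1 : signchar n 1%g = 1 by rewrite signcharE odd_perm1.
have neq_sign : {in chars, forall phi, phi != signchar n * phi}.
  move=> phi; rewrite mem_cat => /orP[/mapP[l Ll ->] | ].
    exact: sign_L.
  case/mapP=> _ /mapP[l Ll ->] ->; rewrite signchar_mulK eq_sym.
  exact: sign_L.
have deg_chars : {in chars &, forall phi psi : 'CF('Sym_('I_n)), phi 1%g = psi 1%g}.
  suff [d deg_d] : exists d, {in phis, forall phi : 'CF('Sym_('I_n)), phi 1%g = d}.
    suff deg (phi : 'CF('Sym_('I_n))) : phi \in chars -> phi 1%g = d
      by move=> phi psi /deg -> /deg ->.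
    rewrite mem_cat => /orP[/deg_d // | /mapP[psi /deg_d deg_psi ->]].
    by rewrite cfunE sgn1 mul1r.
  case: (L) deg_L @phis {chars irr_phis irr_chars neq_sign} => [|l0 L'] degL' phis.
    by exists 0.
  exists (symchar n l0 1%g) => _ /mapP[l Ll ->].
  by apply: degL'; rewrite ?mem_head.
have uniq_chars : uniq chars.
  rewrite cat_uniq (map_inj_uniq (can_inj signchar_mulK)).
  have uniq_phis : uniq phis.
    rewrite map_inj_in_uniq // => l l' Ll Ll' eq_ll'.
    have := symchar_dot (beta_L Ll) (beta_L Ll'); rewrite -eq_ll'.
    rewrite symchar_dot ?beta_L // eqxx; case: eqP => // _ /eqP.
    by rewrite oner_eq0.
  rewrite uniq_phis andbT /=; apply/hasPn=> _ /mapP[_ /mapP[l Ll ->] ->].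
  apply/mapP=> -[l' Ll' /eqP eq_sgn].
  by have /negP[] := sign_L Ll Ll'; rewrite eq_sym.
have cfIirrK phi : phi \in chars -> 'chi_(cfIirr phi) = phi.
  by move/irr_chars/cfIirrE.
exists [set i in map cfIirr chars]; split.
- rewrite cardsE (card_uniqP _).
    by rewrite size_map size_cat !size_map addnn.
  rewrite map_inj_in_uniq // => phi psi cphi cpsi eq_i.
  by rewrite -(cfIirrK phi) // eq_i cfIirrK.
- move=> i j; rewrite !inE => /mapP[phi cphi ->] /mapP[psi cpsi ->].
  by rewrite !cfIirrK //; apply: deg_chars.
- move=> i; rewrite inE => /mapP[phi cphi ->]; rewrite cfIirrK //.
  by apply: cfRes_Alt_irr => //; [apply: irr_chars | apply: neq_sign].
Qed.

End SameDegree.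

(** * Partitions with equal hook products *)

Section BetaSeq.

Implicit Types (s t : seq nat).

Definition beta_seq n k s : bool :=
  [&& size s == k, sorted ltn s & sumn s == (n + sumn (iota 0 k))%N].

(* The truncated subtractions are harmless: [s] is always increasing. *)
Fixpoint vdm s : nat :=
  if s is x :: s' then ((\prod_(y <- s') (y - x)) * vdm s')%N else 1%N.

Definition factprod s : nat := (\prod_(x <- s) x`!)%N.

(** The degree is n! times [vdm s / factprod s]; equality is stated by cross-multiplication to avoid
    division. *)
Definition same_hooks s t : bool :=
  (vdm s * factprod t == vdm t * factprod s)%N.

(** In a beta-set the initial entries equal to their index are the empty rows of the padded
    partition; the others are counted. *)
Definition nrows s : nat :=
  (size s - find (fun i => nth 0%N s i != i) (iota 0 (size s)))%N.

(** The last beta-number is the first row plus [size s - 1], so each clause says that one first row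
    exceeds the number of rows of the other partition. Either clause suffices, the sign twist being
    an involution. *)
Definition separated s t : bool :=
  (size s + nrows t <= last 0 s)%N || (size t + nrows s <= last 0 t)%N.

Definition seq_ffun k s : {ffun 'I_k -> nat} := [ffun i : 'I_k => nth 0%N s i].

Lemma vdmE s : sorted ltn s ->
  (vdm s)%:R = \prod_(i < size s) \prod_(j < size s | (i < j)%N)
                 ((nth 0 s j)%:R - (nth 0 s i)%:R) :> int.
Proof.
elim: s => [|x s IHs] sorted_s; first by rewrite big_ord0.
have lt_xs := order_path_min ltn_trans sorted_s.
rewrite /= natrM IHs ?(path_sorted sorted_s) //= big_ord_recl.
congr (_ * _).
  rewrite [RHS]big_mkcond big_ord_recl /= mul1r natr_prod (big_nth 0%N) big_mkord.
  apply: eq_bigr => j _; rewrite natrB // ltnW //.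
  by apply: (allP lt_xs); rewrite mem_nth.
apply: eq_bigr => i _; rewrite [RHS]big_mkcond big_ord_recl /= mul1r big_mkcond.
by apply: eq_bigr => j _.
Qed.

Lemma nrows_low s j : (j + nrows s < size s)%N -> nth 0%N s j = j.
Proof.
set P := fun i => nth 0%N s i != i.
have le_find : (find P (iota 0 (size s)) <= size s)%N.
  by rewrite -[leqRHS](size_iota 0) find_size.
rewrite /nrows -/P => lt_j; have lt_jf : (j < find P (iota 0 (size s)))%N by lia.
have := before_find 0%N lt_jf; rewrite nth_iota ?add0n; last by lia.
by move/negbFE/eqP.
Qed.

Variables n k : nat.

Lemma beta_seqP s : beta_seq n k s -> beta_set n (seq_ffun k s).
Proof.
case/and3P=> /eqP size_s sorted_s /eqP sum_s; apply/andP; split.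
  apply/forallP=> i; apply/forallP=> j; apply/implyP=> lt_ij; rewrite !ffunE.
  by rewrite (sorted_ltn_nth ltn_trans) // inE size_s.
under eq_bigr do rewrite ffunE.
rewrite -(big_mkord xpredT (nth 0%N s)) -{1}size_s -(big_nth 0%N xpredT id).
by rewrite -(big_mkord xpredT id) /index_iota subn0 -!sumnE sum_s.
Qed.

Lemma factprodE s : size s = k -> (\prod_(i < k) (seq_ffun k s i)`! = factprod s)%N.
Proof.
move=> size_s; rewrite /factprod (big_nth 0%N) size_s big_mkord.
by apply: eq_bigr => i _; rewrite ffunE.
Qed.

Lemma same_hooks_degree s t : beta_seq n k s -> beta_seq n k t ->
  same_hooks s t ->
  symchar n (seq_ffun k s) 1%g = symchar n (seq_ffun k t) 1%g.
Proof.
move=> bs bt /eqP/(congr1 (fun a => a%:R : int)); rewrite !natrM => eq_st.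
have degE u : beta_seq n k u ->
    symcharZ (seq_ffun k u) (1%g : {perm 'I_n}) * (factprod u)%:R
      = n`!%:R * (vdm u)%:R.
  move=> bu; have [/eqP size_u sorted_u _] := and3P bu.
  have := symcharZ_degree (beta_seqP bu); rewrite factprodE // => ->.
  rewrite vdmE // size_u; congr (_ * _).
  by apply: eq_bigr => i _; apply: eq_bigr => j _; rewrite !ffunE.
have fp_neq0 u : (factprod u)%:R != 0 :> int.
  by rewrite pnatr_eq0 -lt0n prodn_gt0 // => i; rewrite fact_gt0.
rewrite !symcharE; congr (_%:~R).
apply: (mulIf (mulf_neq0 (fp_neq0 s) (fp_neq0 t))).
rewrite mulrA degE // -mulrA eq_st [RHS]mulrCA mulrC.
by rewrite degE //; ring.
Qed.

Lemma separated_neq_sign s t : (0 < k)%N -> beta_seq n k s -> beta_seq n k t ->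
  separated s t ->
  symchar n (seq_ffun k t) != signchar n * symchar n (seq_ffun k s).
Proof.
move=> k_gt0 bs bt; have lt_k1 : (k.-1 < k)%N by rewrite prednK.
have lowP u : beta_seq n k u ->
    forall j : 'I_k, (j + nrows u < k)%N -> seq_ffun k u j = j.
  case/and3P=> /eqP size_u _ _ j lt_jk; rewrite ffunE nrows_low //.
  by rewrite [ltnRHS]size_u.
have lastE u : beta_seq n k u -> seq_ffun k u (Ordinal lt_k1) = last 0%N u.
  by case/and3P=> /eqP size_u _ _; rewrite ffunE /= -size_u nth_last.
have sizeE u : beta_seq n k u -> size u = k by case/and3P=> /eqP.
case/orP=> long; first apply: (@symchar_neq_sign _ _ _ _ (nrows t) (Ordinal lt_k1)).
- exact: beta_seqP.
- by rewrite lastE // -(sizeE s).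
- exact: lowP.
suff : symchar n (seq_ffun k s) != signchar n * symchar n (seq_ffun k t).
  by apply: contraNneq => ->; rewrite signchar_mulK.
apply: (@symchar_neq_sign _ _ _ _ (nrows s) (Ordinal lt_k1)).
- exact: beta_seqP.
- by rewrite lastE // -(sizeE t).
- exact: lowP.
Qed.

Lemma same_degree_of_beta_seqs (L : seq (seq nat)) :
  (1 < n)%N -> (0 < k)%N -> uniq L -> all (beta_seq n k) L ->
  {in L &, forall s t, same_hooks s t} ->
  {in L &, forall s t, separated s t} ->
  same_degree_Alt_irr n (size L).*2.
Proof.
move=> n_gt1 k_gt0 uniq_L /allP beta_L hooks_L sep_L.
rewrite -(size_map (seq_ffun k) L).
apply: same_degree_of_beta_sets => //.
- rewrite map_inj_in_uniq // => s t Ls Lt /ffunP eq_st.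
  have /and3P[/eqP size_s _ _] := beta_L _ Ls.
  have /and3P[/eqP size_t _ _] := beta_L _ Lt.
  apply: (@eq_from_nth _ 0%N) => [|i]; rewrite size_s ?size_t // => lt_ik.
  by have := eq_st (Ordinal lt_ik); rewrite !ffunE.
- by move=> _ /mapP[s Ls ->]; apply/beta_seqP/beta_L.
- move=> _ _ /mapP[s Ls ->] /mapP[t Lt ->].
  by apply: same_hooks_degree; rewrite ?beta_L ?hooks_L.
- move=> _ _ /mapP[s Ls ->] /mapP[t Lt ->].
  by apply: separated_neq_sign; rewrite ?beta_L ?sep_L.
Qed.

End BetaSeq.

Local Open Scope nat_scope.

(** * Checking finite families in binary arithmetic *)

Section BinaryCheck.

Implicit Types (s t : seq nat).

Lemma to_nat_mul a b : N.to_nat (N.mul a b) = N.to_nat a * N.to_nat b.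
Proof. exact: Nnat.N2Nat.inj_mul. Qed.

Definition prodN (f : nat -> N) s : N := foldr (fun x a => N.mul (f x) a) (Npos xH) s.

Lemma prodNE f s : N.to_nat (prodN f s) = \prod_(x <- s) N.to_nat (f x).
Proof.
elim: s => [|x s IHs]; first by rewrite big_nil.
by rewrite big_cons /= to_nat_mul IHs.
Qed.

Definition factN n : N := prodN N.of_nat (iota 1 n).

Lemma factNE n : N.to_nat (factN n) = n`!.
Proof.
rewrite prodNE fact_prod /index_iota subSS subn0.
by apply: eq_bigr => i _; rewrite Nnat.Nat2N.id.
Qed.

Fixpoint vdmN s : N :=
  if s is x :: s' then N.mul (prodN (fun y => N.of_nat (y - x)) s') (vdmN s')
  else (Npos xH).

Lemma vdmNE s : N.to_nat (vdmN s) = vdm s.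
Proof.
elim: s => //= x s IHs; rewrite to_nat_mul IHs prodNE; congr (_ * _).
by apply: eq_bigr => y _; rewrite Nnat.Nat2N.id.
Qed.

Definition same_hooksN s t : bool :=
  N.mul (vdmN s) (prodN factN t) == N.mul (vdmN t) (prodN factN s).

Lemma same_hooksNP s t : same_hooksN s t -> same_hooks s t.
Proof.
have factprodE u : N.to_nat (prodN factN u) = factprod u.
  by rewrite prodNE; apply: eq_bigr => x _; rewrite factNE.
move/eqP/(congr1 N.to_nat); rewrite !to_nat_mul !vdmNE !factprodE => eq_st.
exact/eqP.
Qed.

(* [s] is a partition, in weakly decreasing order, padded to [k] parts. *)
Definition beta_of k s : seq nat := [seq nth 0 s (k - i.+1) + i | i <- iota 0 k].

(** All partitions are padded to the length of the longest. The relation [separated] is also tested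
    on the diagonal, which separates each character from its own twist. *)
Definition good_family n (P : seq (seq nat)) : bool :=
  let k := foldr maxn 0 (map size P) in
  let L := map (beta_of k) P in
  [&& 0 < k, uniq L, all (beta_seq n k) L, allrel same_hooksN L L & allrel separated L L].

Lemma same_degree_of_family n P : 1 < n -> good_family n P ->
  same_degree_Alt_irr n (size P).*2.
Proof.
move=> n_gt1; rewrite /good_family; set k := foldr _ _ _.
case/and5P=> k_gt0 uniq_L beta_L /allrelP hooks_L /allrelP sep_L.
rewrite -(size_map (beta_of k) P); apply: (same_degree_of_beta_seqs n_gt1 k_gt0) => //.
by move=> s t Ls Lt; apply: same_hooksNP; apply: hooks_L.
Qed.

End BinaryCheck.

(* Entry [n - 11] lists partitions of n with the same hook product, found by a
   computer search. *)
Definition small_families : seq (seq (seq nat)) := [::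
  [:: [:: 6; 3; 2]; [:: 5; 4; 2]];
  [:: [:: 7; 3; 2]; [:: 6; 2; 2; 2]];
  [:: [:: 10; 2; 1]; [:: 9; 4]];
  [:: [:: 9; 2; 2; 1]; [:: 8; 5; 1]];
  [:: [:: 9; 4; 1; 1]; [:: 7; 4; 4]];
  [:: [:: 9; 3; 3; 1]; [:: 8; 5; 3]];
  [:: [:: 8; 5; 4]; [:: 8; 6; 3]; [:: 7; 7; 2; 1]];
  [:: [:: 11; 3; 2; 1; 1]; [:: 10; 2; 2; 2; 1; 1]; [:: 8; 7; 1; 1; 1]];
  [:: [:: 11; 4; 2; 1; 1]; [:: 9; 2; 2; 2; 2; 1; 1]; [:: 9; 6; 1; 1; 1; 1]];
  [:: [:: 9; 5; 5; 1]; [:: 6; 5; 5; 4]; [:: 6; 6; 4; 4]];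
  [:: [:: 9; 3; 3; 3; 1; 1; 1]; [:: 9; 6; 2; 1; 1; 1; 1]; [:: 9; 5; 4; 3];
    [:: 8; 4; 3; 3; 3]];
  [:: [:: 11; 5; 2; 2; 2]; [:: 10; 3; 2; 2; 1; 1; 1; 1; 1]; [:: 9; 7; 5; 1];
    [:: 7; 6; 6; 3]];
  [:: [:: 11; 5; 4; 1; 1; 1]; [:: 11; 6; 3; 1; 1; 1]; [:: 9; 7; 5; 2];
    [:: 8; 6; 5; 4]];
  [:: [:: 13; 3; 2; 2; 1; 1; 1; 1]; [:: 11; 9; 2; 1; 1];
    [:: 10; 2; 2; 2; 2; 2; 2; 1; 1]; [:: 9; 7; 7; 1]];
  [:: [:: 11; 5; 5; 2; 2]; [:: 7; 5; 5; 5; 3]; [:: 10; 8; 4; 1; 1; 1];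
    [:: 9; 7; 6; 1; 1; 1]];
  [:: [:: 9; 8; 7; 2]; [:: 10; 7; 7; 1; 1]; [:: 14; 6; 3; 2; 1];
    [:: 7; 6; 6; 6; 1]];
  [:: [:: 9; 9; 5; 3; 1]; [:: 9; 7; 7; 3; 1]; [:: 12; 5; 5; 3; 2];
    [:: 9; 5; 5; 4; 4]];
  [:: [:: 11; 9; 5; 3]; [:: 10; 10; 5; 2; 1]; [:: 9; 9; 7; 2; 1];
    [:: 9; 6; 6; 6; 1]];
  [:: [:: 12; 8; 5; 4]; [:: 14; 7; 5; 2; 1]; [:: 11; 10; 3; 3; 2];
    [:: 12; 5; 4; 4; 4]];
  [:: [:: 10; 7; 5; 4; 4]; [:: 9; 7; 6; 4; 4]; [:: 11; 5; 5; 5; 3; 1];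
    [:: 8; 6; 6; 6; 3; 1]];
  [:: [:: 12; 7; 7; 5]; [:: 14; 7; 7; 2; 1]; [:: 10; 10; 8; 2; 1];
    [:: 9; 7; 7; 7; 1]];
  [:: [:: 11; 9; 6; 3; 2; 1]; [:: 10; 9; 6; 3; 2; 2]; [:: 10; 7; 6; 3; 3; 3];
    [:: 8; 6; 6; 5; 4; 3]];
  [:: [:: 12; 9; 8; 4]; [:: 9; 9; 7; 7; 1]; [:: 8; 8; 8; 7; 1; 1];
    [:: 15; 10; 3; 2; 2; 1]];
  [:: [:: 13; 10; 6; 5]; [:: 14; 9; 8; 2; 1]; [:: 12; 7; 7; 7; 1];
    [:: 9; 9; 8; 7; 1]];
  [:: [:: 11; 10; 6; 6; 2]; [:: 11; 7; 7; 5; 5]; [:: 11; 7; 6; 6; 5];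
    [:: 10; 7; 7; 6; 5]];
  [:: [:: 12; 8; 8; 6; 2]; [:: 9; 9; 8; 6; 4]; [:: 11; 11; 7; 5; 1; 1];
    [:: 10; 10; 9; 3; 2; 2]];
  [:: [:: 14; 8; 7; 6; 2]; [:: 14; 9; 5; 5; 4]; [:: 14; 7; 7; 5; 4];
    [:: 15; 10; 6; 4; 1; 1]];
  [:: [:: 11; 9; 8; 7; 3]; [:: 11; 9; 8; 5; 5]; [:: 10; 9; 8; 6; 5];
    [:: 15; 8; 8; 4; 2; 1]];
  [:: [:: 16; 11; 6; 5; 1]; [:: 13; 8; 8; 8; 2]; [:: 17; 11; 6; 2; 2; 1];
    [:: 19; 8; 6; 3; 2; 1]];
  [:: [:: 10; 9; 9; 7; 3; 2]; [:: 11; 11; 6; 6; 3; 3]; [:: 9; 8; 7; 7; 6; 3];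
    [:: 10; 7; 7; 7; 5; 4]];
  [:: [:: 14; 11; 8; 7; 1]; [:: 11; 8; 8; 8; 6]; [:: 11; 9; 7; 7; 7];
    [:: 10; 9; 8; 7; 7]];
  [:: [:: 13; 12; 8; 7; 2]; [:: 14; 11; 10; 4; 3]; [:: 14; 9; 8; 8; 3];
    [:: 14; 12; 6; 5; 5]];
  [:: [:: 15; 13; 7; 5; 2; 1]; [:: 17; 10; 7; 6; 2; 1]; [:: 17; 7; 7; 6; 3; 3];
    [:: 12; 7; 7; 7; 7; 3]];
  [:: [:: 12; 10; 8; 8; 6]; [:: 15; 9; 9; 8; 2; 1]; [:: 11; 11; 7; 7; 7; 1];
    [:: 10; 9; 9; 8; 7; 1]];
  [:: [:: 13; 11; 8; 8; 5]; [:: 13; 11; 9; 6; 6]; [:: 13; 13; 9; 7; 2; 1];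
    [:: 12; 11; 11; 7; 2; 2]];
  [:: [:: 13; 13; 9; 6; 4; 1]; [:: 15; 11; 7; 6; 6; 1];
    [:: 12; 11; 7; 7; 7; 2]; [:: 12; 8; 7; 7; 7; 5]];
  [:: [:: 15; 13; 11; 5; 2; 1]; [:: 17; 10; 9; 8; 2; 1];
    [:: 20; 11; 7; 4; 3; 2]; [:: 13; 12; 12; 4; 4; 2]];
  [:: [:: 13; 12; 9; 6; 3; 3; 2]; [:: 13; 12; 6; 6; 5; 4; 2];
    [:: 13; 11; 9; 6; 3; 3; 3]; [:: 13; 8; 7; 6; 6; 4; 4]];
  [:: [:: 15; 15; 13; 5; 1]; [:: 18; 13; 13; 3; 2]; [:: 20; 12; 12; 3; 1; 1];
    [:: 22; 12; 10; 2; 2; 1]];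
  [:: [:: 17; 13; 11; 7; 2]; [:: 13; 12; 12; 9; 4]; [:: 14; 12; 8; 8; 8];
    [:: 13; 13; 11; 10; 2; 1]];
  [:: [:: 17; 13; 12; 6; 3]; [:: 16; 14; 12; 6; 3]; [:: 16; 15; 9; 8; 3];
    [:: 16; 10; 9; 8; 8]];
  [:: [:: 15; 12; 11; 8; 6]; [:: 19; 14; 7; 6; 5; 1]; [:: 16; 15; 11; 4; 4; 2];
    [:: 17; 16; 7; 6; 3; 3]];
  [:: [:: 18; 12; 10; 9; 4]; [:: 19; 13; 12; 5; 3; 1]; [:: 14; 14; 8; 8; 8; 1];
    [:: 17; 17; 8; 5; 3; 3]];
  [:: [:: 18; 10; 9; 9; 8]; [:: 19; 11; 11; 10; 2; 1]; [:: 17; 9; 9; 9; 9; 1];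
    [:: 17; 15; 13; 3; 3; 3]];
  [:: [:: 17; 13; 10; 10; 5]; [:: 19; 10; 10; 10; 5; 1];
    [:: 19; 14; 7; 7; 7; 1]; [:: 17; 15; 13; 6; 2; 2]];
  [:: [:: 19; 13; 12; 9; 3]; [:: 21; 12; 10; 9; 4]; [:: 21; 11; 10; 9; 5];
    [:: 20; 15; 9; 6; 6]];
  [:: [:: 18; 17; 12; 7; 3]; [:: 16; 15; 12; 11; 3]; [:: 23; 12; 10; 8; 4];
    [:: 16; 14; 12; 12; 2; 1]];
  [:: [:: 19; 15; 14; 10]; [:: 19; 16; 12; 11]; [:: 18; 16; 13; 11];
    [:: 17; 17; 17; 4; 2; 1]];
  [:: [:: 18; 15; 14; 7; 5]; [:: 18; 14; 14; 8; 5]; [:: 17; 13; 13; 8; 8];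
    [:: 19; 16; 11; 10; 2; 1]];
  [:: [:: 19; 14; 11; 8; 7; 1]; [:: 17; 14; 12; 11; 4; 2];
    [:: 15; 12; 12; 10; 9; 2]; [:: 14; 12; 11; 10; 10; 3]];
  [:: [:: 14; 11; 11; 10; 9; 6]; [:: 16; 11; 10; 10; 7; 7];
    [:: 15; 11; 11; 10; 7; 7]; [:: 15; 11; 10; 9; 9; 7]];
  [:: [:: 16; 15; 12; 12; 7]; [:: 15; 15; 13; 11; 8]; [:: 16; 15; 11; 11; 9];
    [:: 15; 14; 14; 13; 3; 3]];
  [:: [:: 16; 15; 13; 10; 9]; [:: 15; 15; 15; 11; 6; 1];
    [:: 21; 17; 14; 5; 3; 3]; [:: 16; 14; 14; 13; 3; 3]];
  [:: [:: 19; 16; 15; 8; 5; 1]; [:: 17; 16; 15; 8; 7; 1];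
    [:: 19; 14; 14; 8; 8; 1]; [:: 17; 14; 14; 9; 9; 1]];
  [:: [:: 29; 19; 10; 7]; [:: 30; 17; 10; 8]; [:: 30; 20; 9; 5; 1];
    [:: 35; 14; 7; 6; 2; 1]];
  [:: [:: 17; 15; 12; 9; 9; 4]; [:: 16; 16; 11; 10; 8; 5];
    [:: 17; 15; 12; 8; 7; 7]; [:: 18; 16; 15; 7; 5; 4; 1]];
  [:: [:: 22; 21; 12; 7; 3; 2]; [:: 19; 19; 14; 11; 2; 1; 1];
    [:: 21; 15; 15; 12; 2; 1; 1]; [:: 21; 19; 16; 6; 2; 2; 1]];
  [:: [:: 19; 17; 12; 12; 6; 2]; [:: 22; 18; 11; 6; 6; 5];
    [:: 22; 14; 14; 9; 7; 1; 1]; [:: 21; 19; 12; 5; 5; 5; 1]];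
  [:: [:: 22; 19; 16; 8; 3; 1]; [:: 25; 15; 14; 11; 3; 1];
    [:: 20; 18; 18; 7; 3; 3]; [:: 22; 19; 12; 12; 2; 1; 1]];
  [:: [:: 20; 17; 14; 10; 9]; [:: 19; 19; 15; 8; 8; 1];
    [:: 22; 21; 11; 10; 4; 2]; [:: 20; 20; 16; 7; 5; 2]];
  [:: [:: 20; 18; 17; 8; 5; 3]; [:: 22; 18; 15; 6; 5; 5];
    [:: 24; 19; 12; 8; 6; 1; 1]; [:: 21; 19; 16; 6; 6; 2; 1]];
  [:: [:: 23; 18; 13; 8; 7; 3]; [:: 19; 14; 13; 12; 11; 3];
    [:: 22; 17; 14; 10; 7; 1; 1]; [:: 22; 17; 16; 9; 5; 2; 1]];
  [:: [:: 22; 17; 15; 13; 5; 1]; [:: 23; 17; 13; 13; 6; 1];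
    [:: 20; 15; 15; 14; 8; 1]; [:: 20; 20; 12; 11; 9; 1]];
  [:: [:: 23; 16; 12; 12; 6; 5]; [:: 16; 16; 12; 12; 11; 7];
    [:: 16; 16; 12; 11; 11; 8]; [:: 18; 15; 15; 13; 10; 2; 1]];
  [:: [:: 20; 18; 16; 11; 7; 3]; [:: 23; 15; 13; 12; 9; 3];
    [:: 19; 18; 15; 13; 6; 4]; [:: 23; 15; 10; 10; 9; 8]];
  [:: [:: 21; 19; 15; 8; 8; 4; 1]; [:: 21; 14; 14; 11; 11; 4; 1];
    [:: 19; 17; 17; 11; 6; 5; 1]; [:: 19; 14; 11; 11; 10; 10; 1]];
  [:: [:: 22; 19; 18; 11; 7]; [:: 19; 19; 16; 14; 9]; [:: 19; 19; 15; 14; 10];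
    [:: 20; 16; 16; 14; 11]];
  [:: [:: 20; 20; 13; 13; 9; 2; 1]; [:: 21; 17; 17; 10; 10; 2; 1];
    [:: 20; 18; 18; 9; 9; 2; 2]; [:: 17; 17; 16; 15; 9; 2; 2]];
  [:: [:: 24; 17; 14; 14; 8; 1; 1]; [:: 21; 20; 17; 10; 9; 1; 1];
    [:: 21; 20; 13; 12; 11; 1; 1]; [:: 26; 22; 13; 8; 7; 2; 1]];
  [:: [:: 22; 18; 13; 12; 12; 3]; [:: 23; 13; 12; 11; 11; 10];
    [:: 26; 19; 12; 10; 10; 2; 1]; [:: 26; 15; 13; 13; 10; 2; 1]];
  [:: [:: 22; 18; 17; 13; 8; 3]; [:: 20; 18; 17; 13; 10; 3];
    [:: 24; 19; 16; 13; 6; 2; 1]; [:: 24; 19; 13; 11; 11; 2; 1]];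
  [:: [:: 24; 18; 15; 12; 10; 3]; [:: 24; 16; 15; 14; 9; 4];
    [:: 25; 19; 15; 9; 7; 7]; [:: 25; 16; 15; 9; 9; 8]];
  [:: [:: 22; 21; 15; 14; 9; 2]; [:: 23; 22; 17; 12; 6; 3];
    [:: 22; 22; 18; 11; 6; 4]; [:: 22; 21; 12; 12; 12; 4]]].

Lemma small_families_good :
  all (fun n => good_family n (nth [::] small_families (n - 11))) (iota 11 73).
Proof. by vm_compute. Qed.

Lemma vdm_cat s t : vdm (s ++ t) = vdm s * vdm t * \prod_(x <- s) \prod_(y <- t) (y - x).
Proof.
elim: s => [|x s IHs] /=; first by rewrite big_nil muln1 mul1n.
by rewrite IHs big_cat big_cons /=; ring.
Qed.

Lemma vdm_shift p s : vdm [seq p + u | u <- s] = vdm s.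
Proof.
elim: s => //= x s ->; congr (_ * _); rewrite big_map.
by apply: eq_bigr => y _; rewrite subnDl.
Qed.

(** The differences run through p + u, ..., u + 1. The same product thus occurs in [vdm] and in
    [factprod] of a long beta-set, and it cancels. *)
Lemma prod_shift_sub p u :
  (\prod_(x <- iota 1 p) (p + u.+1 - x)) * u`! = (p + u)`!.
Proof.
rewrite -(@ffact_fact (p + u) p) ?leq_addr // addKn ffact_prod.
have -> : iota 1 p = index_iota 1 p.+1 by rewrite /index_iota subn1.
rewrite big_add1 /= big_mkord; congr (_ * _).
by apply: eq_bigr => i _; rewrite addnS subSS.
Qed.

(** * Infinite families built around a fixed core *)

Section LongFamily.

Variable e : nat.

(* Beta-numbers of the partition with first row p + e - 16, then the rows of the
   partition of 16 parts with beta-numbers b, each longer by one box, and then p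
   rows with a single box. *)
Definition long_beta p (b : seq nat) : seq nat :=
  iota 1 p ++ [seq p + u.+1 | u <- b] ++ [:: p.*2 + e].

(** After cancellation the dependence on p and the core is confined to the ratio [E / F], and the
    permutation hypothesis equates the linear factors p + v of [E b * F c] and [E c * F b]. *)
Lemma same_hooks_long p b c :
  all (fun u => u.+1 < e) b -> all (fun u => u.+1 < e) c -> same_hooks b c ->
  perm_eq ([seq e - u.+1 | u <- b] ++ [seq u.+1 | u <- c])
          ([seq e - u.+1 | u <- c] ++ [seq u.+1 | u <- b]) ->
  same_hooks (long_beta p b) (long_beta p c).
Proof.
move=> b_lt c_lt /eqP hooks_bc perm_bc.
(* The core entries p + u + 1 contribute [A] as differences to 1, ..., p and [E] as differences to
   the last entry 2p + e; [F] is the top factor of their factorials. *)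
pose A d := \prod_(u <- d) \prod_(x <- iota 1 p) (p + u.+1 - x).
pose E d := \prod_(u <- d) (p + (e - u.+1)).
pose F d := \prod_(u <- d) (p + u.+1).
pose V := vdm (iota 1 p) * \prod_(x <- iota 1 p) (p.*2 + e - x).
have vdm_long d : all (fun u => u.+1 < e) d ->
    vdm (long_beta p d) = V * vdm d * E d * A d.
  move=> /allP d_lt; rewrite /long_beta !vdm_cat [vdm [:: _]]/= big_nil !muln1.
  rewrite (_ : vdm [seq p + u.+1 | u <- d] = vdm d); last first.
    rewrite -[RHS](vdm_shift p.+1); congr vdm; apply: eq_map => u.
    by rewrite addnS addSn.
  have -> : \prod_(x <- [seq p + u.+1 | u <- d]) \prod_(y <- [:: p.*2 + e]) (y - x) = E d.
    rewrite big_map; apply: eq_big_seq => u /d_lt/ltnW lt_ue; rewrite big_seq1.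
    by rewrite -addnn -addnA subnDl addnBA.
  have -> : \prod_(x <- iota 1 p)
      \prod_(y <- [seq p + u.+1 | u <- d] ++ [:: p.*2 + e]) (y - x)
      = A d * \prod_(x <- iota 1 p) (p.*2 + e - x).
    rewrite /A [X in _ = X * _]exchange_big -big_split /=.
    by apply: eq_bigr => x _; rewrite big_cat big_map big_seq1.
  by rewrite /V /A; ring.
have fact_long d :
    factprod (long_beta p d) = factprod (iota 1 p) * (p.*2 + e)`! * F d * A d * factprod d.
  rewrite /factprod /long_beta !big_cat /= big_map big_seq1.
  have -> : \prod_(u <- d) (p + u.+1)`! = F d * A d * \prod_(u <- d) u`!.
    rewrite -!big_split /=; apply: eq_bigr => u _.
    by rewrite -mulnA prod_shift_sub addnS factS.
  ring.
have EF : E b * F c = E c * F b.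
  have EFE d d' : E d * F d' =
      \prod_(v <- [seq e - u.+1 | u <- d] ++ [seq u.+1 | u <- d']) (p + v).
    by rewrite big_cat !big_map.
  by rewrite !EFE; apply: perm_big.
rewrite /same_hooks !vdm_long // !fact_long; apply/eqP.
set W := factprod (iota 1 p); set L := _`!.
transitivity (V * A b * A c * W * L * (vdm b * factprod c) * (E b * F c)); first by ring.
by rewrite hooks_bc EF; ring.
Qed.

Lemma sorted_long p b : sorted ltn b -> all (fun u => u.+1 < e) b ->
  sorted ltn (long_beta p b).
Proof.
rewrite !(sorted_pairwise ltn_trans) => sorted_b /allP b_lt.
rewrite /long_beta !pairwise_cat -!(sorted_pairwise ltn_trans) iota_ltn_sorted /=.
rewrite andbT; apply/and3P; split.
- apply/allrelP=> x y; rewrite mem_iota mem_cat inE => /andP[ge_x lt_x].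
  by case/orP=> [/mapP[u _ ->] | /eqP->] /=; lia.
- apply/allrelP=> x y /mapP[u /b_lt lt_ue ->]; rewrite inE => /eqP-> /=; lia.
- rewrite (sorted_pairwise ltn_trans) pairwise_map.
  by apply: sub_pairwise sorted_b => u v /=; rewrite ltn_add2l ltnS.
Qed.

End LongFamily.

Lemma sumn_iota i p : (sumn (iota i p)).*2 = p * (i.*2 + p.-1).
Proof.
elim: p i => // p IHp i; rewrite /= doubleD IHp.
by case: p {IHp} => [|p] /=; lia.
Qed.

(* The hook products of [long_beta e p b] and [long_beta e p b'] differ by the
   ratio of those of b and b' and by prod (p + v) / prod (p + v'), where v and v'
   range over the two lists compared below. *)
Definition good_core e c (M : seq (seq nat)) : bool :=
  let B := map (beta_of 16) M in
  [&& uniq B,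
      all (fun b => [&& size b == 16, sorted ltn b, all (fun u => u.+1 < e) b
                      & sumn b == c]) B,
      allrel same_hooksN B B
    & allrel (fun b b' => perm_eq ([seq e - u.+1 | u <- b] ++ [seq u.+1 | u <- b'])
                                  ([seq e - u.+1 | u <- b'] ++ [seq u.+1 | u <- b])) B B].

(** The size 2p + c - 85 is the sum of the p + 17 beta-numbers, p(p + 1)/2 + 16(p + 1) + c + 2p +
    35, less (p + 17)(p + 16)/2. Doubled sums are compared below to avoid halves. *)
Lemma same_degree_of_core p c M : good_core 35 c M -> 101 <= c ->
  same_degree_Alt_irr (p.*2 + c - 85) (size M).*2.
Proof.
rewrite /good_core; set B := map _ _.
case/and4P=> uniq_B /allP B_ok /allrelP hooks_B /allrelP perm_B le_c.
have size_M : size M = size (map (long_beta 35 p) B) by rewrite !size_map.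
rewrite size_M; apply: (@same_degree_of_beta_seqs _ (p + 17)).
- lia.
- lia.
- rewrite map_inj_uniq // => b b'.
  rewrite /long_beta !cats1 => /eqP.
  rewrite eqseq_cat // eqxx /= eqseq_rcons => /andP[/eqP + _].
  by apply: inj_map => u v; lia.
- rewrite all_map; apply/allP=> b /B_ok /and4P[/eqP size_b sorted_b b_lt /eqP sum_b].
  rewrite /= /beta_seq sorted_long //.
  have -> : size (long_beta 35 p b) = p + 17.
    by rewrite /long_beta !size_cat size_iota size_map size_b.
  have sum_shift : sumn [seq p + u.+1 | u <- b] = 16 * p.+1 + c.
    rewrite -sum_b -size_b; elim: (b) => //= u d ->; lia.
  rewrite eqxx /long_beta !sumn_cat sum_shift /=; apply/eqP.
  have sum1 : (sumn (iota 1 p)).*2 = p * p + p.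
    by rewrite sumn_iota; case: (p) => // q; rewrite -mulnSr.
  have sum0 : (sumn (iota 0 (p + 17))).*2 = (p + 17) * (p + 16).
    by rewrite sumn_iota addnS /=; congr (_ * _); lia.
  move: sum1 sum0; move: (sumn (iota 1 p)) (sumn (iota 0 (p + 17))) => S1 S0.
  by lia.
- move=> _ _ /mapP[b Bb ->] /mapP[b' Bb' ->].
  have [/and4P[_ _ b_lt _] /and4P[_ _ b'_lt _]] := (B_ok _ Bb, B_ok _ Bb').
  apply: same_hooks_long => //; last exact: perm_B.
  exact/same_hooksNP/hooks_B.
- move=> _ _ /mapP[b Bb ->] /mapP[b' Bb' ->].
  have [/and4P[/eqP sz_b _ _ _] /and4P[/eqP sz_b' _ _ _]] := (B_ok _ Bb, B_ok _ Bb').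
  (* Bounding the rows by all p + 17 entries is enough: 2(p + 17) < 2p + 35. *)
  apply/orP; left.
  have size_long d : size d = 16 -> size (long_beta 35 p d) = p + 17.
    by rewrite /long_beta !size_cat size_iota size_map => -> /=; lia.
  have : nrows (long_beta 35 p b') <= p + 17.
    by rewrite -(size_long b') // leq_subr.
  have -> : last 0 (long_beta 35 p b) = p.*2 + 35.
    by rewrite /long_beta catA cats1 last_rcons.
  rewrite size_long //; lia.
Qed.

(** Partitions of 49 with at most 16 parts: their 16 beta-numbers sum to 49 + 120 = 169, so n = 2p +
    84. *)
Definition even_core : seq (seq nat) := [::
  [:: 18; 12; 3; 3; 3; 2; 2; 2; 2; 1; 1];
  [:: 18; 11; 3; 3; 3; 2; 2; 2; 2; 2; 1];
  [:: 13; 6; 3; 3; 3; 3; 3; 3; 3; 3; 1; 1; 1; 1; 1; 1];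
  [:: 11; 11; 3; 3; 3; 2; 2; 2; 2; 2; 2; 2; 1; 1; 1; 1]].

(** The even core with every third part raised from 3 to 4, which gives n = 2p + 85. *)
Definition odd_core : seq (seq nat) := [::
  [:: 18; 12; 4; 3; 3; 2; 2; 2; 2; 1; 1];
  [:: 18; 11; 4; 3; 3; 2; 2; 2; 2; 2; 1];
  [:: 13; 6; 4; 3; 3; 3; 3; 3; 3; 3; 1; 1; 1; 1; 1; 1];
  [:: 11; 11; 4; 3; 3; 2; 2; 2; 2; 2; 2; 2; 1; 1; 1; 1]].

Lemma even_core_good : good_core 35 169 even_core.
Proof. by vm_compute. Qed.

Lemma odd_core_good : good_core 35 170 odd_core.
Proof. by vm_compute. Qed.

(** * Assembling all n from 11 on *)

Lemma same_degree_large n : 84 <= n -> same_degree_Alt_irr n 8.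
Proof.
move=> le_n; pose p := (n - 84)./2.
case odd_n: (odd n).
  have -> : n = p.*2 + 170 - 85.
    by have := odd_double_half (n - 84); rewrite oddB ?odd_n //= /p; lia.
  exact: (same_degree_of_core p odd_core_good).
have -> : n = p.*2 + 169 - 85.
  by have := odd_double_half (n - 84); rewrite oddB ?odd_n //= /p; lia.
exact: (same_degree_of_core p even_core_good).
Qed.

Lemma same_degree_small n : 11 <= n < 84 ->
  same_degree_Alt_irr n (size (nth [::] small_families (n - 11))).*2.
Proof.
case/andP=> le_n lt_n; apply: same_degree_of_family; first lia.
by apply: (allP small_families_good); rewrite mem_iota le_n.
Qed.

Lemma size_small_families :
  all (fun n => size (nth [::] small_families (n - 11))
                  == if n < 17 then 2 else if n < 21 then 3 else 4) (iota 11 73).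
Proof. by vm_compute. Qed.

Lemma same_degree_all n : 11 <= n ->
  same_degree_Alt_irr n (if n < 17 then 4 else if n < 21 then 6 else 8).
Proof.
move=> le_n; case: (ltnP n 84) => [lt_n | ge_n]; last first.
  have [-> ->] : (n < 17) = false /\ (n < 21) = false by lia.
  exact: same_degree_large.
have range_n : n \in iota 11 73 by rewrite mem_iota le_n.
have := same_degree_small (n := n); rewrite le_n lt_n => /(_ isT).
rewrite (eqP (allP size_small_families n range_n)).
by do 2?case: ifP.
Qed.

Theorem theorem1p1 (n : nat) (n_gt0 : (0 < n)%N) :
  [/\ (11 <= n)%N -> (4 <= m n)%N,
      (17 <= n)%N -> (6 <= m n)%N
    & (21 <= n)%N -> (8 <= m n)%N] /\
  [/\ (11 <= n)%N -> same_degree_Alt_irr n 4,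
      (17 <= n)%N -> same_degree_Alt_irr n 6
    & (21 <= n)%N -> same_degree_Alt_irr n 8].
Proof.
suff [deg4 deg6 deg8] : [/\ (11 <= n)%N -> same_degree_Alt_irr n 4,
      (17 <= n)%N -> same_degree_Alt_irr n 6
    & (21 <= n)%N -> same_degree_Alt_irr n 8].
  split; split=> // le_n; apply: same_degree_le_m.
  - exact: deg4.
  - exact: deg6.
  - exact: deg8.
split=> le_n; (have /same_degree_all : 11 <= n by lia) => deg_n;
  apply: same_degree_Alt_irr_le deg_n;
  case: (ltnP n 17) => ?; case: (ltnP n 21) => ?; lia.
Qed.
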